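(* Suppose $S/K$ is a singular primary $K$-extension and let $M=\mathbb{Q}(\Omega)$ be the corresponding singular primary $\mathbb{Q}$-field. Let $d$ be the multiplicative order of $v\mu^{-1}$ modulo $p$. Then there are exactly $\frac{p-1}{d}+1$ prime ideals $\mathfrak p_0,\mathfrak p_1,\dots,\mathfrak p_{(p-1)/d}$ of $M$ lying over $p$, with ramification indices $e(\mathfrak p_0/p\mathbb{Z})=1$ and $e(\mathfrak p_j/p\mathbb{Z})=d$ for all $j=1,\dots,\frac{p-1}{d}$, where $d>1$.
   Context: $p$ is an odd prime, $\zeta$ a primitive $p$-th root of unity, $K=\mathbb{Q}(\zeta)$, $O_K$ its ring of integers, $K^+$ its maximal real subfield with unit group $O_{K^+}^*$, $\lambda=\zeta-1$, $\pi=\lambda O_K$. $v$ is a fixed primitive root mod $p$, $\sigma$ the automorphism of $K$ with $\sigma(\zeta)=\zeta^v$. $C_p$ is the group of ideal classes of $K$ of order dividing $p$, $C_p^\pm$ its subgroups of classes fixed/inverted by complex conjugation. For $A$ with $v_\pi(A)=0$: semi-primary means $A\equiv a\pmod{\pi^2}$, primary means $A\equiv a^p\pmod{\pi^p}$, for some rational integer $a$. $A\in O_K$ is singular if $A^{1/p}\notin K$ and $AO_K=\mathfrak a^p$. Let $1\le\mu\le p-1$. Singular data: (negative) $\Gamma\subset C_p^-$ of order $p$ annihilated by $\sigma-\mu$, $A$ singular semi-primary with $AO_K=\mathfrak a^p$, $\mathfrak a$ non-principal, $Cl(\mathfrak a)\in\Gamma$, $Cl(\mathfrak a)^{\sigma-\mu}=1$,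 $\sigma(A)=A^\mu\alpha^p$ ($\alpha\in K$), $\mu\equiv v^{2m+1}$, $1\le m\le(p-3)/2$, $\pi^{2m+1}\mid A-a^p$ for an integer $1\le a\le p-1$; (positive) the same with $\Gamma\subset C_p^+$, $\mu\equiv v^{2m}$, $\pi^{2m}\mid A-a^p$; (unit) $A\in O_{K^+}^*$ semi-primary with $A^{1/p}\notin K$, $\sigma(A)=A^\mu\alpha^p$ ($\alpha\in O_{K^+}^*$), $\mu\equiv v^{2m}$, $1\le m\le(p-3)/2$, $\pi^{2m}\mid A-a^p$. $S=K(A^{1/p})$ is the corresponding singular $K$-extension, called primary if $A$ is primary. Let $\omega=A^{(p-1)/p}$ (a fixed $p$-th root of $A^{p-1}$), so $S=K(\omega)$. The automorphisms of $S$ extending $\sigma$ are $\sigma_{(w)}(\omega)=\omega^\mu\alpha^{p-1}\zeta^w$, $w=0,\dots,p-1$; $\sigma_\mu$ is the unique one with $\alpha^{p-1}\zeta^w\equiv 1\pmod{\pi^2}$. $\Omega=\sum_{i=0}^{p-2}\sigma_\mu^i(\omega)$, and $M=\mathbb{Q}(\Omega)$ (a subfield of $S$ of degree $p$ over $\mathbb{Q}$) is called the singular primary $\mathbb{Q}$-field when $S$ is primary. *)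

(* Defs.v *)
From HB Require Import structures.
From mathcomp Require Import all_boot all_order all_fingroup all_algebra all_field.
From mathcomp Require Import boolp classical_sets functions cardinality.

Set Implicit Arguments.
Unset Strict Implicit.
Unset Printing Implicit Defensive.

Import GRing.Theory.

Local Open Scope classical_set_scope.
Local Open Scope ring_scope.

(* All number fields below are subfields E of one ambient number field L, which
   is normal over Q; ideals of O_E are subsets of L contained in E. *)

Section Ideals.
Variable L : splittingFieldType rat.
Implicit Types (E : {vspace L}) (I J P : set L).

Definition ring_of_integers E : set L :=
  [set x | x \in E /\ integralOver (intr : int -> L) x].

Definition integral_units E : set L :=
  [set x | [/\ x != 0, ring_of_integers E x & ring_of_integers E x^-1]].

Definition is_ideal E I : Prop :=
  [/\ I `<=` ring_of_integers E, I 0,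
      forall x y, I x -> I y -> I (x + y)
    & forall a x, ring_of_integers E a -> I x -> I (a * x)].

Definition nonzero_ideal E I : Prop :=
  is_ideal E I /\ exists2 x, I x & x != 0.

Definition scale_ideal (a : L) I : set L := [set a * x | x in I].

Definition principal_ideal E (a : L) : set L :=
  scale_ideal a (ring_of_integers E).

Definition is_principal E I : Prop :=
  exists2 a, ring_of_integers E a & I = principal_ideal E a.

Definition mul_ideal I J : set L :=
  [set z | exists n (x y : 'I_n -> L),
     (forall i, I (x i) /\ J (y i)) /\ z = \sum_(i < n) x i * y i].

Definition exp_ideal E I (n : nat) : set L :=
  iter n (mul_ideal I) (ring_of_integers E).

Definition dvd_ideal E I J : Prop :=
  exists2 C, is_ideal E C & J = mul_ideal I C.

Definition prime_ideal E P : Prop :=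
  [/\ is_ideal E P, ~ P 1
    & forall x y, ring_of_integers E x -> ring_of_integers E y ->
        P (x * y) -> P x \/ P y].

Definition prime_over E (p : nat) P : Prop :=
  prime_ideal E P /\ (forall n : int, P n%:~R <-> (p%:Z %| n)%Z).

Definition ramification_index E (p : nat) P (e : nat) : Prop :=
  dvd_ideal E (exp_ideal E P e) (principal_ideal E p%:R) /\
  ~ dvd_ideal E (exp_ideal E P e.+1) (principal_ideal E p%:R).

(* For x, y in E that need not be integral: the congruence is taken in the
   localization of O_E at the prime P, i.e. it says v_P(x - y) >= n. *)
Definition congr_ideal_exp E P (n : nat) (x y : L) : Prop :=
  exists s, [/\ ring_of_integers E s, ~ P s & exp_ideal E P n (s * (x - y))].

Definition ideal_class E I : set (set L) :=
  [set J | nonzero_ideal E J /\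
     exists x y, [/\ ring_of_integers E x, ring_of_integers E y,
       x != 0, y != 0 & scale_ideal x I = scale_ideal y J]].

Definition class_group E : set (set (set L)) :=
  [set ideal_class E I | I in nonzero_ideal E].

Definition class_one E : set (set L) := ideal_class E (ring_of_integers E).

Definition class_mul E (C D : set (set L)) : set (set L) :=
  [set J | exists I1 I2,
     [/\ C I1, D I2 & ideal_class E (mul_ideal I1 I2) J]].

Definition class_exp E (C : set (set L)) (n : nat) : set (set L) :=
  iter n (class_mul E C) (class_one E).

Definition class_image (s : L -> L) (C : set (set L)) : set (set L) :=
  [set s @` I | I in C].

Definition class_subgroup E (G : set (set (set L))) : Prop :=
  [/\ G `<=` class_group E, G (class_one E),
      forall C D, G C -> G D -> G (class_mul E C D)
    & forall C, G C -> exists2 D, G D & class_mul E C D = class_one E].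

End Ideals.

Definition cyclotomic_field (L : splittingFieldType rat) (zeta : L)
  : {subfield L} := <<1%AS; zeta>>%AS.

Section SingularData.
Variables (L : splittingFieldType rat) (p v : nat) (zeta : L).
Let K : {subfield L} := cyclotomic_field zeta.
(* sg maps zeta to zeta ^ v.  cc maps zeta to zeta^-1: it is induced by complex
   conjugation under every embedding of K in the complex numbers. *)
Variables (sg cc : gal_of K).
Implicit Types (A alpha : L) (mu k m : nat).

Definition Kplus : {vspace L} := fixedField <[cc]>%g.

Definition pi_ideal : set L := principal_ideal K (zeta - 1).

Definition semi_primary A : Prop :=
  [/\ ring_of_integers K A, ~ pi_ideal A
    & exists a : int, exp_ideal K pi_ideal 2 (A - a%:~R)].

Definition primary A : Prop :=
  [/\ ring_of_integers K A, ~ pi_ideal A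
    & exists a : int, exp_ideal K pi_ideal p (A - a%:~R ^+ p)].

Definition pth_power_in_K A : Prop := exists2 B, B \in K & B ^+ p = A.

Definition singular A : Prop :=
  [/\ ring_of_integers K A, ~ pth_power_in_K A
    & exists2 I, is_ideal K I & principal_ideal K A = exp_ideal K I p].

Definition Cp : set (set (set L)) :=
  [set C | class_group K C /\ class_exp K C p = class_one K].

Definition Cp_plus : set (set (set L)) :=
  [set C | Cp C /\ class_image cc C = C].

Definition Cp_minus : set (set (set L)) :=
  [set C | Cp C /\ class_mul K C (class_image cc C) = class_one K].

Definition annihilated_by_sigma_minus mu (C : set (set L)) : Prop :=
  class_image sg C = class_exp K C mu.

Definition pi_exp_dvd_sub_pth_power A k : Prop :=
  exists a : nat, (1 <= a <= p.-1)%N /\ exp_ideal K pi_ideal k (A - a%:R ^+ p).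

Definition singular_class_data (Cpm : set (set (set L))) mu A alpha k : Prop :=
  exists (Gamma : set (set (set L))) (I : set L),
  [/\ [/\ class_subgroup K Gamma, Gamma `<=` Cpm, (Gamma #= `I_p)%card
        & forall C, Gamma C -> annihilated_by_sigma_minus mu C],
      singular A /\ semi_primary A,
      [/\ is_ideal K I, principal_ideal K A = exp_ideal K I p,
          ~ is_principal K I, Gamma (ideal_class K I)
        & annihilated_by_sigma_minus mu (ideal_class K I)],
      alpha \in K /\ sg A = A ^+ mu * alpha ^+ p
    & (mu = v ^ k %[mod p])%N /\ pi_exp_dvd_sub_pth_power A k].

Definition singular_negative mu A alpha : Prop :=
  exists m, (1 <= m <= (p - 3)./2)%N /\
    singular_class_data Cp_minus mu A alpha (2 * m + 1)%N.

Definition singular_positive mu A alpha : Prop :=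
  exists m, (1 <= m <= (p - 3)./2)%N /\
    singular_class_data Cp_plus mu A alpha (2 * m)%N.

Definition singular_unit mu A alpha : Prop :=
  exists m, (1 <= m <= (p - 3)./2)%N /\
  [/\ integral_units Kplus A, semi_primary A, ~ pth_power_in_K A,
      integral_units Kplus alpha /\ sg A = A ^+ mu * alpha ^+ p
    & (mu = v ^ (2 * m) %[mod p])%N /\ pi_exp_dvd_sub_pth_power A (2 * m)%N].

Definition singular_data mu A alpha : Prop :=
  [\/ singular_negative mu A alpha, singular_positive mu A alpha
    | singular_unit mu A alpha].

End SingularData.

(* The field K(A^{1/p}), where r is a chosen p-th root of A. *)
Definition kummer_extension (L : splittingFieldType rat) (zeta r : L)
  : {subfield L} := <<cyclotomic_field zeta; r>>%AS.

(* s is the extension of sg to S = K(r) written sigma_mu; omega is a p-th root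
   of A ^ (p - 1). *)
Definition is_sigma_mu (L : splittingFieldType rat) (p mu : nat)
    (zeta alpha r omega : L) (sg : gal_of (cyclotomic_field zeta))
    (s : gal_of (kummer_extension zeta r)) : Prop :=
  {in cyclotomic_field zeta, s =1 sg} /\
  exists w : nat, [/\ (w < p)%N,
    s omega = omega ^+ mu * alpha ^+ p.-1 * zeta ^+ w
  & congr_ideal_exp (cyclotomic_field zeta) (pi_ideal zeta) 2
      (alpha ^+ p.-1 * zeta ^+ w) 1].

Definition Omega_elt (L : splittingFieldType rat) (p : nat) (zeta r omega : L)
    (s : gal_of (kummer_extension zeta r)) : L :=
  \sum_(i < p.-1) (s ^+ i)%g omega.

Definition singular_Q_field (L : splittingFieldType rat) (p : nat)
    (zeta r omega : L) (s : gal_of (kummer_extension zeta r)) : {subfield L} :=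
  <<1%AS; Omega_elt p omega s>>%AS.

(* Main.v *)
Require Import Defs.
From HB Require Import structures.
From mathcomp Require Import all_boot all_order all_fingroup all_algebra all_field.
From mathcomp Require Import boolp classical_sets functions cardinality.
From mathcomp Require Import ring zify.

(** Write lam = zeta - 1, K = Q(zeta), S = K(omega). Comparing A = a^p + lam^p c with
    sigma(A) = A^mu alpha^p modulo lam^(p+1) gives (v - mu) c = 0 modulo lam; since mu is a power
    v^k with 1 < k < p-1, the primary number A is even a p-th power modulo lam^(p+1), so that
    omega = 1 + lam t with t^p - t divisible by lam. Hence b^p - b is divisible by lam for all b
    in O_S, and the prime lam splits completely in S: the ring homomorphisms ("places") O_S -> F_p are
    determined by their value at t, which is arbitrary. A generator of Gal(S/K) shifts this value,
    and sigma_mu, because of its normalization modulo pi^2, multiplies it by mu/v.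

    M is the fixed field of sigma_mu, which has order p-1, so the primes of M over p correspond to
    the orbits of multiplication by mu/v on F_p: the orbit of 0 and (p-1)/d orbits of size d. The
    stabilizer of a place acts on lam through a power of v, hence the elements of M have valuation
    at a place divisible by the order (p-1)/e of this stabilizer, where e is the orbit size. As p
    has valuation p-1, the ramification index is e. *)

Set Implicit Arguments.
Unset Strict Implicit.
Unset Printing Implicit Defensive.

Import GRing.Theory.
Local Open Scope classical_set_scope.
Local Open Scope ring_scope.

(** * Subrings and Frobenius congruences *)

(** [O_S] itself is not computed; only its localization at p is, as that of [O_K[t]]. If b^p - b
    lies in lam B for all b in B, the Frobenius is the identity on B/lam B, so this ring is reduced,
    and an integral x with lam^m x in B already lies in B. The same argument first compares O_K with
    Z[zeta].

    Ideals are compared place by place. An element of O_S that vanishes at no place divides its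
    norm, an integer prime to p; hence an ideal of S or M that contains such an element and a power
    of p contains 1. The factorization P^e C = (p) behind the ramification index is obtained by
    producing such an element.

    A^(p-1) replaces A because a^(p-1) = 1 modulo lam turns a congruence with a p-th power into a
    congruence with 1, so that omega - 1 can be divided by lam. The inequality d > 1 is the same
    fact, mu distinct from v modulo p, that makes c vanish. *)

Definition is_subring (R : nzRingType) (B : set R) : Prop :=
  [/\ B 1, forall x y, B x -> B y -> B (x - y)
    & forall x y, B x -> B y -> B (x * y)].

Section Subring.
Variables (R : nzRingType) (B : set R).
Hypothesis subB : is_subring B.

Lemma subring1 : B 1. Proof. by case: subB. Qed.
Lemma subringB x y : B x -> B y -> B (x - y). Proof. by case: subB => _ + _; apply. Qed.
Lemma subringM x y : B x -> B y -> B (x * y). Proof. by case: subB => _ _; apply. Qed.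
Lemma subring0 : B 0. Proof. by rewrite -(subrr 1); apply: subringB; apply: subring1. Qed.
Lemma subringN x : B x -> B (- x).
Proof. by rewrite -sub0r; apply: subringB; apply: subring0. Qed.
Lemma subringD x y : B x -> B y -> B (x + y).
Proof. by move=> Bx /subringN By; rewrite -(opprK y); apply: subringB. Qed.
Lemma subringX x n : B x -> B (x ^+ n).
Proof.
move=> Bx; elim: n => [|n IH]; first exact: subring1.
by rewrite exprS; apply: subringM.
Qed.
Lemma subring_sum (I : Type) (r : seq I) (P : pred I) (F : I -> R) :
  (forall i, P i -> B (F i)) -> B (\sum_(i <- r | P i) F i).
Proof. by move=> BF; apply: big_ind => //; [exact: subring0 | exact: subringD]. Qed.
Lemma subring_prod (I : Type) (r : seq I) (P : pred I) (F : I -> R) :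
  (forall i, P i -> B (F i)) -> B (\prod_(i <- r | P i) F i).
Proof. by move=> BF; apply: big_ind => //; [exact: subring1 | exact: subringM]. Qed.
Lemma subring_nat n : B n%:R.
Proof.
elim: n => [|n IH]; first exact: subring0.
by rewrite mulrS; apply: subringD => //; apply: subring1.
Qed.
Lemma subring_int (n : int) : B n%:~R.
Proof. by case: n => n; [|apply: subringN]; apply: subring_nat. Qed.

End Subring.

Definition multiples (R : nzRingType) (B : set R) (a : R) : set R :=
  [set x | exists2 y, B y & x = a * y].

Section Multiples.
Variables (R : comNzRingType) (B : set R) (a : R).
Hypothesis subB : is_subring B.
Local Notation aB := (multiples B a).

Lemma multiples0 : aB 0.
Proof. by exists 0; rewrite ?mulr0 //; apply: subring0. Qed.
Lemma multiplesD x y : aB x -> aB y -> aB (x + y).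
Proof.
move=> [u Bu ->] [w Bw ->]; exists (u + w); first exact: subringD.
by rewrite mulrDr.
Qed.
Lemma multiplesN x : aB x -> aB (- x).
Proof. by move=> [u Bu ->]; exists (- u); [exact: subringN|rewrite mulrN]. Qed.
Lemma multiplesB x y : aB x -> aB y -> aB (x - y).
Proof. by move=> ? ?; apply: multiplesD => //; apply: multiplesN. Qed.
Lemma multiplesMl x y : B x -> aB y -> aB (x * y).
Proof.
move=> Bx [u Bu ->]; exists (x * u); first exact: subringM.
by rewrite mulrCA.
Qed.
Lemma multiplesMr x y : B y -> aB x -> aB (x * y).
Proof. by rewrite mulrC; apply: multiplesMl. Qed.
Lemma multiples_self y : B y -> aB (a * y).
Proof. by move=> By; exists y. Qed.
Lemma multiples_sum (I : Type) (r : seq I) (P : pred I) (F : I -> R) :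
  (forall i, P i -> aB (F i)) -> aB (\sum_(i <- r | P i) F i).
Proof. by move=> BF; apply: big_ind => //; [exact: multiples0 | exact: multiplesD]. Qed.

End Multiples.

Lemma multiplesW (R : comNzRingType) (B : set R) a b x : is_subring B ->
  multiples B b a -> multiples B a x -> multiples B b x.
Proof.
move=> sB [u Bu ->] [w Bw ->]; exists (u * w); first exact: subringM.
by rewrite mulrA.
Qed.

Lemma exprDp (R : comNzRingType) (B : set R) p x y : is_subring B -> prime p ->
  B x -> B y -> multiples B p%:R ((x + y) ^+ p - x ^+ p - y ^+ p).
Proof.
move=> sB p_pr Bx By; case: p p_pr => // p p_pr.
have -> : (x + y) ^+ p.+1 - x ^+ p.+1 - y ^+ p.+1
    = \sum_(i < p) (x ^+ (p - i) * y ^+ i.+1) *+ 'C(p.+1, i.+1).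
  rewrite exprDn big_ord_recl big_ord_recr /= bin0 binn subn0 subnn mulr1 mul1r.
  set s := (X in _ + (X + _) - _ - _); rewrite [RHS](_ : _ = s) //.
  by rewrite !mulr1n; ring.
apply: multiples_sum => // i _.
have /dvdnP[k ->] : (p.+1 %| 'C(p.+1, i.+1))%N by rewrite prime_dvd_bin //= ltnS ltn_ord.
rewrite mulrnA -[X in multiples _ _ X]mulr_natl; apply: multiples_self.
by rewrite -mulr_natr; do ?[apply: subringM|apply: subringX|apply: subring_nat].
Qed.

Lemma fermat_int p (k : int) : prime p -> (p%:Z %| k ^+ p - k)%Z.
Proof.
move=> p_pr.
have charFp : p \in [pchar 'F_p] by exact: pchar_Fp.
have H : ((k ^+ p - k)%:~R : 'F_p) = 0.
  by rewrite rmorphB /= rmorphXn /= -[X in _ ^+ X](card_Fp p_pr) expf_card subrr.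
by rewrite (dvdz_pcharf charFp) H.
Qed.

Section Frobenius.
Variables (R : comNzRingType) (B : set R) (p : nat) (l : R).
Hypotheses (sB : is_subring B) (p_pr : prime p) (lp : multiples B l p%:R).
Local Notation lB := (multiples B l).

Lemma frobeniusD x y : B x -> B y ->
  lB (x ^+ p - x) -> lB (y ^+ p - y) -> lB ((x + y) ^+ p - (x + y)).
Proof.
move=> Bx By Fx Fy.
have -> : (x + y) ^+ p - (x + y)
  = ((x + y) ^+ p - x ^+ p - y ^+ p) + ((x ^+ p - x) + (y ^+ p - y)).
  by ring.
apply: multiplesD => //; last exact: multiplesD.
by apply: multiplesW lp _ => //; apply: exprDp.
Qed.

Lemma frobeniusM x y : B x -> B y ->
  lB (x ^+ p - x) -> lB (y ^+ p - y) -> lB ((x * y) ^+ p - (x * y)).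
Proof.
move=> Bx By Fx Fy.
have -> : (x * y) ^+ p - (x * y) = x ^+ p * (y ^+ p - y) + (x ^+ p - x) * y.
  by rewrite exprMn; ring.
by apply: (multiplesD sB); [apply: (multiplesMl sB) => //; exact: subringX|exact: (multiplesMr sB)].
Qed.

Lemma frobenius_int (n : int) : lB (n%:~R ^+ p - n%:~R).
Proof.
have /dvdzP[k E] := fermat_int n p_pr.
have -> : n%:~R ^+ p - n%:~R = p%:R * k%:~R :> R.
  by rewrite -rmorphXn -rmorphB E rmorphM /= mulrC.
by apply: multiplesMr => //; apply: subring_int.
Qed.

Lemma frobenius_iter k z : (forall b, B b -> lB (b ^+ p - b)) -> B z ->
  lB (z ^+ (p ^ k) - z).
Proof.
move=> Frob Bz; elim: k => [|k IH]; first by rewrite expn0 expr1 subrr; exact: multiples0.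
have -> : z ^+ (p ^ k.+1) - z = ((z ^+ (p ^ k)) ^+ p - z ^+ (p ^ k)) + (z ^+ (p ^ k) - z).
  by rewrite addrA subrK expnSr exprM.
by apply: multiplesD => //; apply: Frob; exact: subringX.
Qed.
End Frobenius.

Definition adjoin (R : nzRingType) (O : set R) (t : R) : set R :=
  [set x | exists2 f : {poly R}, (forall i, O f`_i) & x = f.[t]].

Section Adjoin.
Variables (R : comNzRingType) (O : set R) (t : R).
Hypothesis sO : is_subring O.

Lemma poly_coef_subring : is_subring [set f : {poly R} | forall i, O f`_i].
Proof.
split.
- by move=> i; rewrite coef1; case: eqP => _; [exact: subring1 | exact: subring0].
- by move=> f g Of Og i; rewrite coefB; apply: subringB.
- by move=> f g Of Og i; rewrite coefM; apply: subring_sum => // j _; apply: subringM.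
Qed.

Lemma adjoin_subring : is_subring (adjoin O t).
Proof.
have sP := poly_coef_subring; split.
- by exists 1; [exact: (subring1 sP)|rewrite hornerC].
- move=> _ _ [f Of ->] [g Og ->]; exists (f - g); last by rewrite !hornerE.
  exact: (subringB sP).
- move=> _ _ [f Of ->] [g Og ->]; exists (f * g); last by rewrite !hornerE.
  exact: (subringM sP).
Qed.

Lemma adjoin_base x : O x -> adjoin O t x.
Proof.
move=> Ox; exists x%:P; last by rewrite hornerC.
by move=> i; rewrite coefC; case: eqP => // _; exact: subring0.
Qed.

Lemma adjoin_gen : adjoin O t t.
Proof.
exists 'X; last by rewrite hornerX.
by move=> i; rewrite coefX; exact: subring_nat.
Qed.

Lemma adjoin_min (B : set R) : is_subring B -> O `<=` B -> B t -> adjoin O t `<=` B.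
Proof.
move=> sB OB Bt _ [f Of ->]; rewrite horner_coef.
by apply: subring_sum => // i _; apply: subringM => //; [exact: OB|exact: subringX].
Qed.

(** Since the Frobenius is additive modulo p, the elements satisfying the congruence form a subring,
    so it is enough to check generators. *)
Lemma frobenius_adjoin p l : prime p -> multiples (adjoin O t) l p%:R ->
  (forall x, O x -> multiples (adjoin O t) l (x ^+ p - x)) ->
  multiples (adjoin O t) l (t ^+ p - t) ->
  forall x, adjoin O t x -> multiples (adjoin O t) l (x ^+ p - x).
Proof.
move=> p_pr lp FO Ft x Cx; have sC := adjoin_subring.
suff : adjoin O t `<=` [set y | adjoin O t y /\ multiples (adjoin O t) l (y ^+ p - y)].
  by move=> /(_ _ Cx) [].
apply: adjoin_min; last by split; [exact: adjoin_gen|].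
- split.
  + split; first exact: subring1.
    by rewrite expr1n subrr; apply: multiples0.
  + move=> y z [Cy Fy] [Cz Fz]; split; first exact: subringB.
    apply: frobeniusD => //; first exact: subringN.
    rewrite -mulN1r; apply: frobeniusM => //; first by apply: subringN => //; exact: subring1.
    exact: (frobenius_int sC p_pr lp (-1)).
  + move=> y z [Cy Fy] [Cz Fz]; split; first exact: subringM.
    exact: frobeniusM.
- by move=> y Oy; split; [exact: adjoin_base|exact: FO].
Qed.

End Adjoin.

(** * Integral elements and localization at p *)

Section Descent.
Variables (F : fieldType) (B : set F) (p : nat) (l : F).
Hypotheses (sB : is_subring B) (p_pr : prime p) (l0 : l != 0) (Bl : B l).
Hypothesis Frob : forall b, B b -> multiples B l (b ^+ p - b).

(* B / l B is reduced, so l B cannot contain a power of an element outside l B. *)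
Lemma integral_descent m x : integralOver (intr : int -> F) x ->
  B (l ^+ m * x) -> B x.
Proof.
move=> [f fmon /rootP fx]; elim: m => [|m IH]; first by rewrite mul1r.
move=> Bz; apply: IH; set z := l ^+ m.+1 * x in Bz.
have [n sf lc] : exists2 n, size f = n.+1 & f`_n = 1.
  exists (size f).-1; last exact: monicP fmon.
  by rewrite prednK // lt0n size_poly_eq0 monic_neq0.
(* The monic equation of x, multiplied by l^((m+1)n), expresses z^n through lower powers of z, each
   with a coefficient divisible by l. *)
have zn : multiples B l (z ^+ n).
  have := fx; rewrite horner_coef size_map_poly_id0; last first.
    by rewrite (monicP fmon) rmorph1 oner_neq0.
  rewrite sf big_ord_recr /= coef_map /= lc mul1r.
  move=> /eqP; rewrite addrC addr_eq0 => /eqP xn.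
  rewrite exprMn xn mulrN; apply: multiplesN => //.
  rewrite mulr_sumr; apply: multiples_sum => // i _; rewrite coef_map /=.
  have -> : (l ^+ m.+1) ^+ n * ((f`_i)%:~R * x ^+ i)
     = l * (l ^+ (m + m.+1 * (n - i.+1)) * (f`_i)%:~R * z ^+ i).
    have -> : l ^+ m.+1 ^+ n = l * (l ^+ (m + m.+1 * (n - i.+1)) * l ^+ m.+1 ^+ i).
      rewrite -!exprM -exprD -exprS; congr (_ ^+ _).
      by rewrite -2!addSn -addnA -mulnDr -mulnS; congr (_ * _)%N; rewrite -addnS subnK.
    by rewrite exprMn; ring.
  apply: multiples_self.
  apply: subringM => //; last exact: subringX.
  by apply: subringM => //; [exact: subringX|exact: subring_int].
(* As n <= p^n, also z^(p^n) is divisible by l, and it is congruent to z. So l divides z, and one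
   factor l of z = l^(m+1) x cancels. *)
have : multiples B l (z ^+ (p ^ n) - z) by exact: frobenius_iter.
have /subnKC <- : (n <= p ^ n)%N by apply/ltnW/ltn_expl/prime_gt1.
rewrite exprD => zB; have : multiples B l z.
  rewrite -[z](subKr (z ^+ n * z ^+ (p ^ n - n))).
  by apply: multiplesB => //; apply: multiplesMr => //; apply: subringX.
by case=> y By; rewrite /z exprS -mulrA => /(mulfI l0) ->.
Qed.

End Descent.

Section Localization.
Variables (F : fieldType) (C : set F) (p : nat) (l : F).
Hypotheses (sC : is_subring C) (p_pr : prime p) (l0 : l != 0) (Cl : C l).
Hypothesis lp : multiples C l p%:R.
Hypothesis Frob : forall b, C b -> multiples C l (b ^+ p - b).

(** Only rational integers are inverted, so all primes over p survive together. *)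
Definition localized : set F :=
  [set x | exists2 s, coprime p s & C (s%:R * x)].

Lemma localized_subring : is_subring localized.
Proof.
split.
- by exists 1%N; rewrite ?coprimen1 // mulr1; exact: subring1.
- move=> x y [s cs Cx] [u cu Cy]; exists (s * u)%N; first by rewrite coprimeMr cs.
  rewrite natrM mulrBr; apply: subringB => //.
    by rewrite mulrAC; apply: subringM => //; apply: subring_nat.
  by rewrite -mulrA; apply: subringM => //; apply: subring_nat.
- move=> x y [s cs Cx] [u cu Cy]; exists (s * u)%N; first by rewrite coprimeMr cs.
  by rewrite natrM mulrACA; apply: subringM.
Qed.

Lemma localized_frobenius b : localized b -> multiples localized l (b ^+ p - b).
Proof.
move=> [s cs Cb].
(* The factor s^(p+1) makes everything a polynomial in s b; the error term s^p - s is divisible by l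
   by Fermat. *)
have [c Cc E] : multiples C l ((s ^ p * s)%:R * (b ^+ p - b)).
  have -> : (s ^ p * s)%:R * (b ^+ p - b) =
    s%:R * ((s%:R * b) ^+ p - s%:R * b) - (s%:R ^+ p - s%:R) * (s%:R * b).
    by rewrite exprMn natrM natrX; ring.
  apply: multiplesB => //; first by apply: multiplesMl => //; [apply: subring_nat|apply: Frob].
  apply: multiplesMr => //; exact: (frobenius_int sC p_pr lp s).
exists ((b ^+ p - b) / l); last by rewrite mulrC divfK.
exists (s ^ p * s)%N; first by rewrite coprimeMr cs coprimeXr.
by rewrite mulrA E mulrAC divff // mul1r.
Qed.

(** Write n = s p^m with s prime to p. As p divides l^k, the element l^(km) s x lies in [C]; the
    descent removes the power of l, and s is inverted. *)
Lemma integral_localized k x : multiples C p%:R (l ^+ k) ->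
  integralOver (intr : int -> F) x ->
  (exists2 n, (0 < n)%N & C (n%:R * x)) -> localized x.
Proof.
move=> [c Cc lk] intx [n n0 Cnx].
have [s cs def_n] := pfactor_coprime p_pr n0; set m := logn p n in def_n.
suff [u cu] : localized (s%:R * x).
  by rewrite mulrA -natrM; exists (u * s)%N; rewrite // coprimeMr cu.
apply: (integral_descent localized_subring p_pr l0 _ localized_frobenius (m := k * m)).
- by exists 1%N; rewrite ?coprimen1 // mul1r.
- apply: integral_mul => //; exact: integral_nat.
- exists 1%N; rewrite ?coprimen1 // mul1r exprM lk exprMn -mulrA.
  have -> : p%:R ^+ m * (c ^+ m * (s%:R * x)) = c ^+ m * (n%:R * x) :> F.
    by rewrite def_n natrM natrX; ring.
  by apply: subringM => //; apply: subringX.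
Qed.
End Localization.

(** * Rings of integers *)

Section Integers.
Variable L : splittingFieldType rat.
Implicit Types (E F : {subfield L}).
Local Notation O := ring_of_integers.
Local Notation integral := (integralOver (intr : int -> L)).

Lemma oi_subring E : is_subring (O E).
Proof.
split; first by split; [exact: mem1v|exact: integral1].
- by move=> x y [Ex Ix] [Ey Iy]; split; [exact: rpredB|exact: integral_sub].
- by move=> x y [Ex Ix] [Ey Iy]; split; [exact: rpredM|exact: integral_mul].
Qed.

Lemma oi_sub E F : (E <= F)%VS -> O E `<=` O F.
Proof. by move=> /subvP EF x [/EF Fx Ix]. Qed.

Lemma integral_rmorph_L (f : {rmorphism L -> L}) x : integral x -> integral (f x).
Proof.
move=> [q qmon /rootP qx]; exists q => //; apply/rootP.
have := congr1 f qx; rewrite rmorph0 -horner_map -map_poly_comp => <-.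
by congr (_.[_]); apply: eq_map_poly => n /=; rewrite rmorph_int.
Qed.

Lemma oi_gal E (s : gal_of E) x : O E x -> O E (s x).
Proof.
by move=> [Ex Ix]; split; [exact: memv_gal|exact: (integral_rmorph_L _ Ix)].
Qed.

Lemma integral_monicXn (x y : L) n : (0 < n)%N -> x ^+ n = y -> integral y -> integral x.
Proof.
move=> n0 xy Iy; apply: (integral_root_monic (p := 'X^n - y%:P)).
- exact: monicXnsubC.
- by rewrite rootE !hornerE xy subrr.
- apply/integral_poly => i; rewrite coefB coefXn coefC.
  apply: integral_sub; first exact: integral_nat.
  by case: eqP => // _; exact: integral0.
Qed.

Lemma integral_rat x : x \in 1%VS -> integral x -> exists n : int, x = n%:~R.
Proof.
move=> /vlineP[q ->] [f fmon fx].
have qx : root (map_poly intr f) q.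
  rewrite -(fmorph_root (in_alg L)) -map_poly_comp; move: fx.
  by congr (is_true (root _ _)); apply: eq_map_poly => n; rewrite /= scaler_int.
have : (ratr q : algC) \in Num.int.
  apply: Cint_rat_Aint; first exact: Crat_rat.
  apply: (@root_monic_Aint (map_poly ratr (map_poly intr f))).
  - by rewrite (fmorph_root (ratr : {rmorphism rat -> algC})).
  - by do 2!apply: monic_map.
  - apply/polyOverP => i; rewrite !coef_map /= ratr_int; exact: rpred_int.
move=> /Num.Theory.intrP[n qn]; exists n.
have -> : q = n%:~R by apply: (fmorph_inj (ratr : {rmorphism rat -> algC})); rewrite /= qn ratr_int.
by rewrite scaler_int.
Qed.

Lemma integral_div_int (n m : int) (y : L) : m != 0 -> integral y -> n%:~R = m%:~R * y ->
  (m %| n)%Z.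
Proof.
move=> m0 Iy E.
have m0L : (m%:~R : L) != 0.
  rewrite -(rmorph_int (in_alg L)) fmorph_eq0.
  by rewrite intr_eq0.
have [k yk] : exists k : int, y = k%:~R.
  apply: integral_rat => //.
  have -> : y = n%:~R / m%:~R by rewrite E mulrAC divff // mul1r.
  by apply: rpred_div; apply: rpred_int.
move: E; rewrite yk -rmorphM /= => E; apply/dvdzP; exists k.
have : (n%:~R : rat) = (m * k)%:~R.
  by apply: (fmorph_inj (in_alg L)); rewrite !rmorph_int.
by move/intr_inj => ->; rewrite mulrC.
Qed.

Definition Zset : set L := [set x | exists n : int, x = n%:~R].

Lemma Zset_subring : is_subring Zset.
Proof.
split; first by exists 1.
- by move=> _ _ [n ->] [m ->]; exists (n - m); rewrite rmorphB.
- by move=> _ _ [n ->] [m ->]; exists (n * m); rewrite rmorphM.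
Qed.

Lemma Zset_denominator x : x \in 1%VS -> exists n, (0 < n)%N /\ Zset (n%:R * x).
Proof.
move=> /vlineP[q ->]; exists `|denq q|%N; split; first by rewrite absz_gt0 denq_neq0.
exists (numq q).
have -> : (`|denq q|%N%:R : L) = (denq q)%:~R by rewrite -[in RHS]absz_denq.
have : in_alg L (q * (denq q)%:~R) = (numq q)%:~R by rewrite -numqE rmorph_int.
by rewrite rmorphM rmorph_int /= mulrC.
Qed.

Lemma adjoin_denominator E (R : set L) t : is_subring R ->
  (forall x, x \in E -> exists n, (0 < n)%N /\ R (n%:R * x)) ->
  forall x, x \in <<E; t>>%VS -> exists2 n, (0 < n)%N & adjoin R t (n%:R * x).
Proof.
move=> sR denE _ /Fadjoin_polyP[f /polyOverP Ef ->].
have [d dP] := choice (fun i => denE _ (Ef i)).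
exists (\prod_(i < size f) d i)%N; first by apply: prodn_gt0 => i; case: (dP i).
exists ((\prod_(i < size f) d i)%N%:R *: f); last by rewrite hornerZ.
move=> i; rewrite coefZ; have [lt_i|le_i] := ltnP i (size f); last first.
  by rewrite nth_default // mulr0; exact: subring0.
rewrite (bigD1 (Ordinal lt_i)) //= natrM mulrAC mulrC.
by apply: subringM => //; [exact: subring_nat|case: (dP i)].
Qed.

End Integers.

(** * The ring Z[zeta] and the prime lam *)

Section Cyclotomic.
Variables (L : splittingFieldType rat) (p : nat) (zeta : L).
Hypotheses (p_pr : prime p) (zetaP : p.-primitive_root zeta).
Local Notation lam := (zeta - 1).
Local Notation K := (cyclotomic_field zeta).
Local Notation O := ring_of_integers.
Local Notation Zz := (adjoin (@Zset L) zeta).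
Let sZz : is_subring Zz := adjoin_subring zeta (@Zset_subring L).

Lemma lam_neq0 : lam != 0.
Proof.
rewrite subr_eq0; apply/eqP => z1; have := prime_gt1 p_pr.
by have := prim_order_dvd zetaP 1; rewrite z1 expr1n eqxx dvdn1 => /eqP->.
Qed.

Lemma Zz_lam : Zz lam.
Proof.
by apply: subringB => //; [exact: adjoin_gen (@Zset_subring L)|exact: subring1].
Qed.

(** This is the cyclotomic equation (X^p - 1)/(X - 1) = 0 at X = 1 + lam, expanded in powers of
    lam. *)
Lemma cyclo_sum : \sum_(i < p) 'C(p, i.+1)%:R * lam ^+ i = 0.
Proof.
have : (1 + lam) ^+ p - 1 = 0 by rewrite [1 + _]addrC subrK (prim_expr_order zetaP) subrr.
rewrite exprDn big_ord_recl /= expr0 expr1n mulr1 bin0 mulr1n addrAC subrr add0r.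
move=> E; apply: (mulfI lam_neq0); rewrite mulr0 -[RHS]E mulr_sumr.
apply: eq_bigr => i _; rewrite -[bump 0 i]/i.+1 expr1n mul1r -mulr_natl exprS.
by ring.
Qed.

(** The equation of lam is Eisenstein: its middle coefficients are divisible by p and its constant
    term is p. *)
Lemma lam_pow : exists2 w, Zz w & lam ^+ p.-1 = p%:R * (lam * w - 1).
Proof.
have := cyclo_sum; move: sZz Zz_lam; have := prime_gt1 p_pr.
move: zeta => z; case: p p_pr => [|[|q]] // q_pr _ sZ Zl.
rewrite big_ord_recl big_ord_recr /= bin1 expr0 mulr1.
set S := (X in _ + (X + _)) => E.
pose w : L := \sum_(i < q) ('C(q.+2, i.+2) %/ q.+2)%:R * (z - 1) ^+ i.
have SE : S = q.+2%:R * ((z - 1) * w).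
  rewrite !mulr_sumr; apply: eq_bigr => i _; rewrite -[bump 0 i]/i.+1 exprS.
  have /dvdnP[k ->] : (q.+2 %| 'C(q.+2, i.+2))%N by rewrite prime_dvd_bin //= !ltnS; exact: ltn_ord.
  by rewrite mulnK // natrM; ring.
exists (- w).
  apply: subringN => //; apply: subring_sum => // i _; apply: subringM => //.
    exact: subring_nat.
  by apply: subringX => //.
move: E; rewrite -[bump 0 q]/q.+1 binn mul1r SE => E.
apply/eqP; rewrite -subr_eq0 -[X in _ == X]E; apply/eqP; ring.
Qed.

(** The congruence eps = -1 modulo lam later gives the linear term of tau^p - tau its sign. *)
Lemma p_lam_pow : exists eps w, [/\ Zz eps, Zz w, p%:R = lam ^+ p.-1 * eps
  & eps = lam * w - 1].
Proof.
have [w Zw lamE] := lam_pow.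
have lamX n : Zz (lam ^+ n) by apply: subringX => //; exact: Zz_lam.
(* Powers of lam are split off p one at a time, using p = p lam w - lam^(p-1); no inverse of lam w -
   1 is needed beforehand. *)
have [eps Ze pE] : multiples Zz (lam ^+ p.-1) p%:R.
  have : (p.-1 <= p.-1)%N by []; elim: {1 3}p.-1 => [|j IH] jp.
    by exists p%:R; rewrite ?mul1r //; exact: subring_nat.
  have [|y Zy yE] := IH; first exact: ltnW.
  exists (y * w - lam ^+ (p.-1 - j.+1)).
    by apply: subringB => //; exact: subringM.
  rewrite mulrBr -exprD subnKC // lamE.
  have -> : lam ^+ j.+1 * (y * w) = p%:R * (lam * w) by rewrite yE exprS; ring.
  by ring.
have lam0 : lam ^+ p.-1 != 0 by rewrite expf_neq0 // lam_neq0.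
have eu : eps * (lam * w - 1) = 1.
  by apply: (mulfI lam0); rewrite mulr1 mulrA -pE.
exists eps, (w * eps); split=> //; first exact: subringM.
by rewrite -[X in _ = _ - X]eu; ring.
Qed.

Lemma Zz_lam_p : multiples Zz lam p%:R.
Proof.
have [eps [w [Ze Zw pE _]]] := p_lam_pow.
exists (lam ^+ p.-2 * eps).
  by apply: subringM => //; apply: subringX => //; exact: Zz_lam.
rewrite pE mulrA -exprS; congr (_ ^+ _ * _).
by case: p (prime_gt1 p_pr) => [|[]].
Qed.

Lemma Zz_p_lam_pow : multiples Zz p%:R (lam ^+ p.-1).
Proof.
have [w Zw lamE] := lam_pow; exists (lam * w - 1) => //.
by apply: subringB => //; [apply: subringM => //; exact: Zz_lam | exact: subring1].
Qed.

Lemma Zz_frobenius x : Zz x -> multiples Zz lam (x ^+ p - x).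
Proof.
apply: frobenius_adjoin => //.
- exact: Zset_subring.
- exact: Zz_lam_p.
- by move=> _ [n ->]; apply: frobenius_int => //; exact: Zz_lam_p.
- rewrite (prim_expr_order zetaP); exists (-1); last by rewrite mulrN1 opprB.
  by apply: subringN => //; exact: subring1.
Qed.

Lemma zeta_K : zeta \in K. Proof. exact: memv_adjoin. Qed.

Lemma zeta_integral : integralOver (intr : int -> L) zeta.
Proof.
apply: (integral_monicXn (prime_gt0 p_pr) (prim_expr_order zetaP)); exact: integral1.
Qed.

Lemma Zz_oi : Zz `<=` O K.
Proof.
apply: adjoin_min; first exact: oi_subring.
  by move=> _ [n ->]; apply: subring_int; exact: oi_subring.
by split; [exact: zeta_K|exact: zeta_integral].
Qed.

Lemma Zz_denominator x : x \in K -> exists2 n, (0 < n)%N & Zz (n%:R * x).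
Proof.
by apply: adjoin_denominator; [exact: Zset_subring|exact: Zset_denominator].
Qed.

(** A form of O_K = Z[zeta] local at p, which suffices for congruences modulo lam. *)
Lemma oi_localized x : O K x -> localized Zz p x.
Proof.
move=> [Kx Ix]; apply: (integral_localized _ p_pr lam_neq0 _ _ _ Zz_p_lam_pow) => //.
- exact: Zz_lam.
- exact: Zz_lam_p.
- exact: Zz_frobenius.
- exact: Zz_denominator.
Qed.

Lemma lam_oi : O K lam. Proof. by apply: Zz_oi; exact: Zz_lam. Qed.

Lemma multiples_oi x a : multiples Zz a x -> multiples (O K) a x.
Proof. by move=> [y Zy ->]; exists y => //; exact: Zz_oi. Qed.

Lemma oi_residue x : O K x -> exists n : int, multiples (O K) lam (x - n%:~R).
Proof.
move=> Ox; have [s cs [f fZ sx]] := oi_localized Ox; have sO := oi_subring K.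
(* A polynomial in zeta with integer coefficients is congruent modulo lam to its value at 1. *)
have [m [y Oy xm]] : exists m : int, multiples (O K) lam (s%:R * x - m%:~R).
  have [m mE] : Zset f.[1].
    rewrite horner_coef; apply: subring_sum; first exact: Zset_subring.
    move=> i _; rewrite expr1n mulr1; exact: fZ.
  exists m; rewrite -mE sx; clear -fZ sO zetaP p_pr; elim/poly_ind: f fZ => [|f c IH] fZ.
    by rewrite !horner0 subrr; exact: multiples0.
  have fZ' i : Zset f`_i.
    by have := fZ i.+1; rewrite coefD coefMX coefC /= addr0.
  have Of : adjoin (@Zset L) zeta f.[zeta] by exists f.
  rewrite !hornerMXaddC.
  rewrite [X in multiples _ _ X](_ : _ = (f.[zeta] - f.[1]) * 1 + lam * f.[zeta]); last by ring.
  apply: multiplesD => //; first by rewrite mulr1; exact: IH.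
  by exists f.[zeta] => //; exact: Zz_oi.
have [u [v uv]] : exists u v : int, u * s = 1 + v * p.
  have /coprimezP[[u v] /= uv] : coprimez p s by rewrite /coprimez /= /gcdz /= (eqP cs).
  by exists v, (- u); rewrite mulNr -uv addrAC subrr add0r.
exists (u * m).
have -> : x - (u * m)%:~R = u%:~R * (s%:R * x - m%:~R) - p%:R * (v%:~R * x).
  have : (u%:~R * s%:R : L) = 1 + v%:~R * p%:R.
    by rewrite -[s%:R]/(s%:~R) -[p%:R]/(p%:~R) -!rmorphM uv rmorphD.
  move=> us; rewrite rmorphM /=.
  have -> : u%:~R * (s%:R * x - m%:~R) = (u%:~R * s%:R) * x - u%:~R * m%:~R by ring.
  by rewrite us; ring.
apply: multiplesB => //; first by apply: multiplesMl => //; [exact: subring_int|exists y].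
apply: multiplesMr => //; first by apply: subringM => //; exact: subring_int.
by apply: multiples_oi; exact: Zz_lam_p.
Qed.

Lemma oi_frobenius x : O K x -> multiples (O K) lam (x ^+ p - x).
Proof.
move=> Ox; have sO := oi_subring K.
have lp := multiples_oi Zz_lam_p.
have [n xn] := oi_residue Ox.
have On : O K n%:~R by exact: subring_int.
rewrite -[x](subrK n%:~R); apply: frobeniusD => //; first exact: subringB.
  apply: multiplesB => //; case: xn => y Oy ->.
  rewrite -[p]prednK ?prime_gt0 // exprS -mulrA; apply: multiples_self.
  by apply: subringM => //; apply: subringX => //; apply: subringM => //; exact: lam_oi.
exact: frobenius_int.
Qed.

End Cyclotomic.

(** As p divides lam^(p-1), the number n^(p-1)/p is integral and rational, hence an integer. *)
Lemma int_lam_dvd (L : splittingFieldType rat) (p : nat) (zeta : L) (E : {subfield L}) (n : int) :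
  prime p -> p.-primitive_root zeta ->
  multiples (ring_of_integers E) (zeta - 1) n%:~R -> (p %| n)%Z.
Proof.
move=> p_pr zetaP [y [_ Iy] nE].
have [u Zu lamE] := Zz_p_lam_pow p_pr zetaP.
have p1 : (0 < p.-1)%N by rewrite -ltnS prednK ?prime_gt0 ?prime_gt1.
have : (p %| n ^+ p.-1)%Z.
  apply: (@integral_div_int L _ p (u * y ^+ p.-1)).
  - by rewrite eqz_nat -lt0n prime_gt0.
  - by apply: integral_mul; [case: (Zz_oi p_pr zetaP Zu)|
      case: (subringX (oi_subring {:L}) p.-1 (conj (memvf y) Iy))].
  - by rewrite rmorphXn /= nE exprMn lamE mulrA.
by rewrite !dvdzE /= abszX Euclid_dvdX // => /andP[].
Qed.

(** * Ideals and places *)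

Section Ideals.
Variable L : splittingFieldType rat.
Implicit Types (E : {subfield L}) (I J : set L).
Local Notation O := ring_of_integers.

Section IdealOps.
Variables (E : {subfield L}) (I : set L).
Hypothesis idI : is_ideal E I.

Lemma idealO x : I x -> O E x. Proof. by case: idI => + _ _ _; apply. Qed.
Lemma ideal0 : I 0. Proof. by case: idI. Qed.
Lemma idealD x y : I x -> I y -> I (x + y).
Proof. by case: idI => _ _ + _; apply. Qed.
Lemma idealMl a x : O E a -> I x -> I (a * x).
Proof. by case: idI => _ _ _; apply. Qed.
Lemma idealMr a x : O E a -> I x -> I (x * a).
Proof. by rewrite mulrC; exact: idealMl. Qed.
Lemma idealN x : I x -> I (- x).
Proof.
move=> Ix; rewrite -mulN1r; apply: idealMl => //.
by apply: (subring_int (oi_subring E) (-1)).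
Qed.
Lemma idealB x y : I x -> I y -> I (x - y).
Proof. by move=> Ix /idealN Iy; exact: idealD. Qed.
Lemma ideal_sum (T : Type) (r : seq T) (P : pred T) (F : T -> L) :
  (forall i, P i -> I (F i)) -> I (\sum_(i <- r | P i) F i).
Proof. by move=> IF; apply: big_ind => //; [exact: ideal0|exact: idealD]. Qed.

Lemma ideal_int_coprime (m n : int) : I m%:~R -> I n%:~R -> coprimez m n -> I 1.
Proof.
move=> Im In /coprimezP[[u v] /= uv].
have -> : 1 = u%:~R * m%:~R + v%:~R * n%:~R :> L by rewrite -!rmorphM -rmorphD uv.
by apply: idealD; apply: idealMl => //; apply: (subring_int (oi_subring E)).
Qed.
End IdealOps.

Lemma oi_is_ideal E : is_ideal E (O E).
Proof.
have sO := oi_subring E; split=> //; first exact: subring0.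
  by move=> x y; exact: subringD.
by move=> x y; exact: subringM.
Qed.

Lemma principalP E a x : principal_ideal E a x <-> multiples (O E) a x.
Proof. by split=> [[y Oy <-]|[y Oy ->]]; exists y. Qed.

Lemma mul_ideal_mem I J x y : I x -> J y -> mul_ideal I J (x * y).
Proof.
move=> Ix Jy; exists 1%N, (fun=> x), (fun=> y); split=> //.
by rewrite big_ord1.
Qed.

Lemma mul_ideal_sub (D I J : set L) :
  D 0 -> (forall x y, D x -> D y -> D (x + y)) ->
  (forall x y, I x -> J y -> D (x * y)) -> mul_ideal I J `<=` D.
Proof.
move=> D0 DD DM _ [n [x [y [IJ ->]]]].
by apply: big_ind => // i _; case: (IJ i); exact: DM.
Qed.

Lemma mul_ideal_is_ideal E I J : is_ideal E I -> is_ideal E J -> is_ideal E (mul_ideal I J).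
Proof.
move=> iI iJ; have sO := oi_subring E; split.
- apply: mul_ideal_sub; [exact: subring0|by move=> ? ?; exact: subringD|].
  by move=> x y /(idealO iI) Ox /(idealO iJ) Oy; exact: subringM.
- by rewrite -(mulr0 0); apply: mul_ideal_mem; [exact: (ideal0 iI)|exact: (ideal0 iJ)].
- move=> _ _ [n [x [y [xy ->]]]] [m [x' [y' [xy' ->]]]].
  pose jn (f : 'I_n -> L) (g : 'I_m -> L) (k : 'I_(n + m)) :=
    match fintype.split k with inl i => f i | inr j => g j end.
  exists (n + m)%N, (jn x x'), (jn y y'); split.
    by rewrite /jn => k; case: (fintype.split k) => ?; [exact: xy|exact: xy'].
  rewrite big_split_ord /= /jn; congr (_ + _); apply: eq_bigr => i _.
    by rewrite (unsplitK (inl _ i)).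
  by rewrite (unsplitK (inr _ i)).
- move=> a _ Oa [n [x [y [xy ->]]]]; exists n, (fun i => a * x i), y; split.
    by move=> i; case: (xy i) => Ix Jy; split=> //; exact: (idealMl iI).
  by rewrite mulr_sumr; apply: eq_bigr => i _; rewrite mulrA.
Qed.

Lemma exp_ideal_is_ideal E I n : is_ideal E I -> is_ideal E (exp_ideal E I n).
Proof.
move=> iI; elim: n => [|n IH]; first exact: oi_is_ideal.
exact: mul_ideal_is_ideal.
Qed.

Lemma exp_ideal_mem E I x n : I x -> exp_ideal E I n (x ^+ n).
Proof.
move=> Ix; elim: n => [|n IH]; first exact: subring1 (oi_subring E).
by rewrite exprS; exact: mul_ideal_mem.
Qed.

End Ideals.

Section Place.
Variables (L : splittingFieldType rat) (E : {subfield L}) (p : nat).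
Local Notation O := (ring_of_integers E).
Let sO := oi_subring E.

(* A place is a ring homomorphism O_E -> F_p, extended arbitrarily to L. *)
Definition place (phi : L -> 'F_p) : Prop :=
  [/\ phi 1 = 1, forall x y, O x -> O y -> phi (x + y) = phi x + phi y
    & forall x y, O x -> O y -> phi (x * y) = phi x * phi y].

Variable phi : L -> 'F_p.
Hypothesis phiP : place phi.

Lemma place1 : phi 1 = 1. Proof. by case: phiP. Qed.
Lemma placeD x y : O x -> O y -> phi (x + y) = phi x + phi y.
Proof. by case: phiP => _ + _; apply. Qed.
Lemma placeM x y : O x -> O y -> phi (x * y) = phi x * phi y.
Proof. by case: phiP => _ _; apply. Qed.
Lemma place0 : phi 0 = 0.
Proof.
have O0 := subring0 sO; apply: (addrI (phi 0)).
by rewrite -placeD // !addr0.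
Qed.
Lemma placeN x : O x -> phi (- x) = - phi x.
Proof.
move=> Ox; apply/eqP; rewrite -addr_eq0 -placeD ?addNr ?place0 //; exact: subringN.
Qed.
Lemma placeB x y : O x -> O y -> phi (x - y) = phi x - phi y.
Proof. by move=> Ox Oy; rewrite placeD ?placeN //; exact: subringN. Qed.
Lemma placeX x n : O x -> phi (x ^+ n) = phi x ^+ n.
Proof.
move=> Ox; elim: n => [|n IH]; first exact: place1.
by rewrite !exprS placeM ?IH //; exact: subringX.
Qed.
Lemma place_sum (I : Type) (r : seq I) (P : pred I) (F : I -> L) :
  (forall i, O (F i)) -> phi (\sum_(i <- r | P i) F i) = \sum_(i <- r | P i) phi (F i).
Proof.
move=> OF; elim: r => [|i r IH]; first by rewrite !big_nil place0.
by rewrite !big_cons; case: ifP => // _; rewrite placeD ?IH //; exact: subring_sum.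
Qed.
Lemma place_prod (I : Type) (r : seq I) (P : pred I) (F : I -> L) :
  (forall i, O (F i)) -> phi (\prod_(i <- r | P i) F i) = \prod_(i <- r | P i) phi (F i).
Proof.
move=> OF; elim: r => [|i r IH]; first by rewrite !big_nil place1.
by rewrite !big_cons; case: ifP => // _; rewrite placeM ?IH //; exact: subring_prod.
Qed.
Lemma place_nat n : phi n%:R = n%:R.
Proof.
elim: n => [|n IH]; first exact: place0.
by rewrite !mulrS placeD ?place1 ?IH //; [exact: subring1|exact: subring_nat].
Qed.
Lemma place_int (n : int) : phi n%:~R = n%:~R.
Proof.
case: n => n; first exact: place_nat.
by rewrite NegzE !rmorphN /= placeN; [rewrite [phi _]place_nat|exact: subring_nat].
Qed.

End Place.

Lemma FpK p (i : 'F_p) : ((i : nat)%:R : 'F_p) = i.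
Proof. exact: natr_Zp. Qed.

Lemma Fp_int_eq0 p (n : int) : prime p -> ((n%:~R : 'F_p) == 0) = (p %| n)%Z.
Proof. by move=> p_pr; rewrite (dvdz_pcharf (pchar_Fp p_pr)). Qed.

Lemma Fp_nat_eq0 p n : prime p -> ((n%:R : 'F_p) == 0) = (p %| n)%N.
Proof. by move=> p_pr; rewrite -(dvdn_pcharf (pchar_Fp p_pr)). Qed.

(** * Primes below a family of places *)

Section Places.
Variables (L : splittingFieldType rat) (p v d : nat) (S M : {subfield L}) (s : gal_of S).
Variables (lam eps u eta t : L) (kap : 'F_p) (phi : 'F_p -> L -> 'F_p).
Local Notation OS := (ring_of_integers S).
Local Notation OM := (ring_of_integers M).
Hypothesis p_pr : prime p.
Hypotheses (lamO : OS lam) (lam0 : lam != 0) (epsO : OS eps) (uO : OS u).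
Hypotheses (p_lam : p%:R = lam ^+ p.-1 * eps) (lam_p : lam ^+ p.-1 = p%:R * u).
Hypothesis frob : forall x, OS x -> multiples OS lam (x ^+ p - x).
Hypothesis phiP : forall i, place S (phi i).
Hypotheses (tO : OS t) (phi_t : forall i, phi i t = i).
Hypothesis phi_s : forall i x, OS x -> phi i (s x) = phi (kap * i) x.
Hypotheses (etaO : OS eta) (s_lam : s lam = lam * eta) (phi_eta : forall i, phi i eta = v%:R).
Hypotheses (vP : (p.-1).-primitive_root (v%:R : 'F_p)) (kapP : d.-primitive_root kap).
Hypothesis MP : forall x, x \in M <-> x \in S /\ s x = x.
Hypothesis s_order : forall x, x \in S -> iter p.-1 s x = x.
Hypothesis normP : forall x, OS x -> (forall i, phi i x != 0) ->
  exists2 y, OS y & exists2 n : int, x * y = n%:~R & ~~ (p %| n)%Z.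

Let sO : is_subring OS := oi_subring S.
Let sOM : is_subring OM := oi_subring M.
Let p1 : (0 < p.-1)%N. Proof. by rewrite -ltnS prednK ?prime_gt0 ?prime_gt1. Qed.
Let Flam n : OS (lam ^+ n). Proof. exact: subringX. Qed.

Let phi1 i := place1 (phiP i).
Let phi0 i := place0 (phiP i).
Let phiB i := @placeB _ _ _ _ (phiP i).
Let phiM i := @placeM _ _ _ _ (phiP i).
Let phiX i := @placeX _ _ _ _ (phiP i).
Let phi_nat i := place_nat (phiP i).
Let phi_sum i := @place_sum _ _ _ _ (phiP i).
Let phi_prod i := @place_prod _ _ _ _ (phiP i).

Lemma kap_order : kap ^+ p.-1 = 1.
Proof.
have kap0 : kap != 0.
  apply/eqP => k0; have := prim_expr_order kapP; rewrite k0 expr0n.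
  by rewrite eqn0Ngt (prim_order_gt0 kapP) => /eqP; rewrite eq_sym oner_eq0.
apply: (mulfI kap0); rewrite -exprS mulr1 prednK ?prime_gt0 //.
by rewrite -[X in _ ^+ X](card_Fp p_pr) expf_card.
Qed.

Lemma phi_lam i : phi i lam = 0.
Proof.
have : phi i lam ^+ p.-1 = 0.
  rewrite -phiX // lam_p phiM //; last exact: subring_nat.
  by rewrite phi_nat // pchar_Fp_0 // mul0r.
by move/eqP; rewrite expf_eq0 => /andP[_ /eqP].
Qed.

Lemma phi_eps i : phi i eps != 0.
Proof.
have eu : eps * u = 1.
  apply: (mulfI (expf_neq0 p.-1 lam0)).
  by rewrite mulr1 mulrA -p_lam -lam_p.
apply/eqP => e0; have := congr1 (phi i) eu.
by rewrite phiM // phi1 // e0 mul0r => /eqP; rewrite eq_sym oner_eq0.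
Qed.

Lemma iter_oi l x : OS x -> OS (iter l s x).
Proof. by move=> Ox; elim: l => //= l IH; exact: oi_gal. Qed.

Lemma phi_iter l i x : OS x -> phi i (iter l s x) = phi (kap ^+ l * i) x.
Proof.
move=> Ox; elim: l i => [|l IH] i; first by rewrite mul1r.
by rewrite /= phi_s ?IH ?mulrA ?exprSr //; exact: iter_oi.
Qed.

Lemma iterM l x y : iter l s (x * y) = iter l s x * iter l s y.
Proof. by elim: l => //= l ->; rewrite rmorphM. Qed.

Lemma iterX l x n : iter l s (x ^+ n) = iter l s x ^+ n.
Proof. by elim: l => //= l ->; rewrite rmorphXn. Qed.

Lemma iter_lam l : exists2 e, OS e &
  iter l s lam = lam * e /\ forall i, phi i e = v%:R ^+ l.
Proof.
elim: l => [|l [e Oe [lE phie]]].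
  exists 1; first exact: subring1.
  by split=> [|i]; rewrite ?mulr1 // phi1.
have Ose := oi_gal s Oe; exists (eta * s e); first exact: subringM.
split=> [|i]; first by rewrite /= lE rmorphM /= s_lam mulrA.
by rewrite phiM // phi_eta phi_s // phie exprS.
Qed.

(* x is divisible by lam ^ n in the localization of O_S at the place phi i. *)
Definition near (i : 'F_p) (n : nat) : set L :=
  [set x | exists2 a, OS a & phi i a != 0 /\ multiples OS (lam ^+ n) (a * x)].

Lemma near0 i n : near i n 0.
Proof.
exists 1; first exact: subring1.
by split; [rewrite phi1 ?oner_eq0|rewrite mulr0; exact: multiples0].
Qed.

Lemma nearD i n x y : near i n x -> near i n y -> near i n (x + y).
Proof.
move=> [a Oa [a0 ax]] [b Ob [b0 byy]]; exists (a * b); first exact: subringM.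
split; first by rewrite phiM // mulf_neq0.
have -> : a * b * (x + y) = b * (a * x) + a * (b * y) by ring.
by apply: multiplesD => //; exact: multiplesMl.
Qed.

Lemma nearM i m n x y : near i m x -> near i n y -> near i (m + n) (x * y).
Proof.
move=> [a Oa [a0 [x' Ox ax]]] [b Ob [b0 [y' Oy byy]]]; exists (a * b); first exact: subringM.
split; first by rewrite phiM // mulf_neq0.
by rewrite mulrACA ax byy exprD mulrACA; apply: multiples_self; exact: subringM.
Qed.

Lemma nearX i m n x : near i m x -> near i (n * m) (x ^+ n).
Proof.
move=> nx; elim: n => [|n IH]; last by rewrite exprS mulSn; exact: nearM.
exists 1; first exact: subring1.
split; first by rewrite phi1 // oner_eq0.
by exists 1; [exact: subring1|rewrite mul0n].
Qed.

Lemma nearW i m n x : (n <= m)%N -> near i m x -> near i n x.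
Proof.
move=> nm [a Oa [a0 ax]]; exists a => //; split=> //.
apply: multiplesW ax => //; exists (lam ^+ (m - n)) => //.
by rewrite -exprD subnKC.
Qed.

Lemma near_oi i x : OS x -> near i 0 x.
Proof.
move=> Ox; exists 1; first exact: subring1.
by split; [rewrite phi1 // oner_eq0|exists x; rewrite ?mul1r].
Qed.

(* 1 - x^(p-1) is a unit at phi i, and its product with x is x - x^p. *)
Lemma near1 i x : OS x -> phi i x = 0 -> near i 1 x.
Proof.
move=> Ox x0; exists (1 - x ^+ p.-1).
  by apply: subringB => //; [exact: subring1|exact: subringX].
split.
  rewrite phiB // ?phi1 ?phiX //; [|exact: subring1|exact: subringX].
  by rewrite x0 expr0n eqn0Ngt p1 subr0 oner_eq0.
rewrite mulrBl mul1r -exprSr prednK ?prime_gt0 // -opprB expr1.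
by apply: multiplesN => //; exact: frob.
Qed.

Lemma near_lamM i n x a : OS a -> phi i a != 0 -> OS x -> near i n.+1 (lam ^+ n * x * a) ->
  phi i x = 0.
Proof.
move=> Oa a0 Ox [b Ob [b0 [y Oy E]]].
have {}E : b * x * a = lam * y.
  by apply: (mulfI (expf_neq0 n lam0)); rewrite [RHS]mulrA -exprSr -E; ring.
have := congr1 (phi i) E; rewrite !phiM ?phi_lam ?mul0r //; last exact: subringM.
by move/eqP; rewrite !mulf_eq0 (negPf b0) (negPf a0) orbF => /eqP.
Qed.

Lemma not_near_p i : ~ near i p p%:R.
Proof.
rewrite -{1}(prednK (prime_gt0 p_pr)) p_lam => np.
have O1 := subring1 sO.
have := @near_lamM i p.-1 1 eps epsO (phi_eps i) O1; rewrite mulr1 => /(_ np).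
by rewrite phi1 // => /eqP; rewrite oner_eq0.
Qed.

(** The numerator of the interpolation polynomial at i, evaluated at t. Since t takes the value k at
    the place k, it is nonzero at the place i only. *)
Definition lagrange (i : 'F_p) : L := \prod_(j : 'F_p | j != i) (t - (j : nat)%:R).

Lemma lagrange_oi i : OS (lagrange i).
Proof.
by apply: subring_prod => // j _; apply: subringB => //; exact: subring_nat.
Qed.

Lemma phi_lagrange k i : phi k (lagrange i) = \prod_(j : 'F_p | j != i) (k - j).
Proof.
rewrite phi_prod //; last by move=> j; apply: subringB => //; exact: subring_nat.
apply: eq_bigr => j _; rewrite phiB //; last exact: subring_nat.
by rewrite phi_t phi_nat // FpK.
Qed.

Lemma phi_lagrange0 k i : k != i -> phi k (lagrange i) = 0.
Proof. by move=> ki; rewrite phi_lagrange (bigD1 k) //= subrr mul0r. Qed.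

Lemma phi_lagrangeN0 i : phi i (lagrange i) != 0.
Proof.
by rewrite phi_lagrange; apply/prodf_neq0 => j ji; rewrite subr_eq0 eq_sym.
Qed.

(** A multiple of x is an integer m prime to p, and Bezout with p^n gives 1. The cofactor m / x lies
    in E because x does, so the argument works for ideals of M as well as of S. *)
Lemma ideal_unit (E : {subfield L}) (I : set L) n x : (E <= S)%VS ->
  is_ideal E I -> I (p%:R ^+ n) -> I x -> (forall i, phi i x != 0) -> I 1.
Proof.
move=> ES idI Ip Ix phix; have Ox := idealO idI Ix.
have [y Oy [m xy pm]] := normP (oi_sub ES Ox) phix.
apply: (@ideal_int_coprime L E I idI (p%:Z ^+ n) m); first by rewrite rmorphXn.
  rewrite -xy; apply: (idealMr idI) => //; split; last by case: Oy.
  have -> : y = m%:~R / x.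
    apply: canRL (mulfK _) _; last by rewrite mulrC.
    by apply/eqP => x0; have := phix 0; rewrite x0 phi0 ?eqxx.
  by apply: rpred_div; [exact: rpred_int|case: Ox].
by rewrite coprimezXl // coprimezE /= prime_coprime.
Qed.

(* The elements a with a x divisible by lam^n form an ideal which contains a power of p and
   is contained in no prime over p. *)
Lemma near_global n x : OS x -> (forall i, near i n x) -> multiples OS (lam ^+ n) x.
Proof.
move=> Ox nx; pose J := [set a | OS a /\ multiples OS (lam ^+ n) (a * x)].
have idJ : is_ideal S J.
  split; first by move=> ? [].
  - by split; [exact: subring0|rewrite mul0r; exact: multiples0].
  - move=> a b [Oa Ja] [Ob Jb]; split; first exact: subringD.
    by rewrite mulrDl; exact: multiplesD.
  - move=> a b Oa [Ob Jb]; split; first exact: subringM.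
    by rewrite -mulrA; exact: multiplesMl.
have /choice[a aP] : forall i, exists a, [/\ OS a, phi i a != 0 & J a].
  by move=> i; have [a Oa [a0 ax]] := nx i; exists a.
suff [_] : J 1 by rewrite mul1r.
(* At the place i all terms but the i-th vanish, and the i-th is a product of two nonzero values. *)
apply: (@ideal_unit S J n (\sum_i a i * lagrange i)) => //.
- split; first by apply: subringX => //; exact: subring_nat.
  apply: multiplesMr => //; exists (lam ^+ (p.-1 * n - n) * eps ^+ n).
    by apply: subringM => //; exact: subringX.
  rewrite mulrA -exprD subnKC ?leq_pmull //.
  by rewrite p_lam exprMn exprM.
- apply: (ideal_sum idJ) => i _; apply: (idealMr idJ); first exact: lagrange_oi.
  by case: (aP i).
- move=> i; have Oal k : OS (a k * lagrange k).
    by apply: subringM => //; [case: (aP k)|exact: lagrange_oi].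
  rewrite phi_sum // (bigD1 i) //= big1 => [|k ki].
    rewrite addr0 phiM ?mulf_neq0 ?phi_lagrangeN0 //; try by case: (aP i).
    exact: lagrange_oi.
  rewrite phiM ?phi_lagrange0 ?mulr0 1?eq_sym //; [by case: (aP k)|exact: lagrange_oi].
Qed.

Lemma oi_M x : OM x <-> OS x /\ s x = x.
Proof.
split=> [[/MP[Sx sx] Ix]|[[Sx Ix] sx]]; first by [].
by split=> //; apply/MP.
Qed.

Lemma M_sub_S : (M <= S)%VS.
Proof. by apply/subvP => x /MP[]. Qed.

Lemma iter_M l x : OM x -> iter l s x = x.
Proof. by move=> /oi_M[_ sx]; elim: l => //= l ->. Qed.

Lemma phi_M l i x : OM x -> phi (kap ^+ l * i) x = phi i x.
Proof. by move=> Mx; have /oi_M[Ox _] := Mx; rewrite -phi_iter // iter_M. Qed.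

Definition trace (x : L) : L := \sum_(l < p.-1) iter l s x.

Lemma trace_M x : OS x -> OM (trace x).
Proof.
move=> Ox; apply/oi_M; split.
  by apply: subring_sum => // l _; exact: iter_oi.
rewrite /trace; have := s_order (proj1 Ox).
case: (p.-1) p1 => // q _ sq; rewrite rmorph_sum /= big_ord_recr big_ord_recl /=.
rewrite -[s (iter q s x)]/(iter q.+1 s x) sq addrC; congr (_ + _).
Qed.

Lemma phi_trace k x : OS x -> phi k (trace x) = \sum_(l < p.-1) phi (kap ^+ l * k) x.
Proof.
move=> Ox; rewrite phi_sum //; last by move=> l; exact: iter_oi.
by apply: eq_bigr => l _; rewrite phi_iter.
Qed.

Lemma natFp_neq0 n : (0 < n <= p.-1)%N -> (n%:R : 'F_p) != 0.
Proof.
move=> /andP[n0 np]; rewrite Fp_nat_eq0 // gtnNdvd //.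
by rewrite -(prednK (prime_gt0 p_pr)).
Qed.

(** The number of terms lies between 1 and p - 1, hence is nonzero in F_p. *)
Lemma sum_indicator (P : pred nat) (a : 'F_p) : (exists2 l, (l < p.-1)%N & P l) ->
  a != 0 -> \sum_(l < p.-1 | P l) a != 0.
Proof.
move=> [l lp Pl] a0; rewrite sumr_const -mulr_natl mulf_neq0 //.
apply: natFp_neq0; apply/andP; split.
  by apply/card_gt0P; exists (Ordinal lp).
by rewrite -[X in (_ <= X)%N]card_ord max_card.
Qed.

(* [sep i] lies in the primes of M below the places outside the orbit of i, and in no other. *)
Definition sep (i : 'F_p) : L := trace (lagrange i).

Lemma sep_M i : OM (sep i). Proof. exact/trace_M/lagrange_oi. Qed.

Definition orbit (i k : 'F_p) : Prop := exists l, kap ^+ l * k = i.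

Lemma orbit_small i k : orbit i k -> exists2 l, (l < p.-1)%N & kap ^+ l * k = i.
Proof.
move=> [l <-]; exists (l %% p.-1)%N; first by rewrite ltn_mod.
by rewrite expr_mod ?kap_order.
Qed.

Lemma phi_orbit i k x : OM x -> orbit i k -> phi i x = phi k x.
Proof. by move=> Mx [l <-]; exact: phi_M. Qed.

Lemma phi_sep i k : orbit i k -> phi k (sep i) != 0.
Proof.
move=> /orbit_small[l lp lk]; rewrite phi_trace; last exact: lagrange_oi.
rewrite (bigID (fun l : 'I_p.-1 => kap ^+ l * k == i)) /= [X in _ + X]big1 ?addr0.
  rewrite (eq_bigr (fun=> phi i (lagrange i))) => [|m /eqP->] //.
  apply: (@sum_indicator (fun l => kap ^+ l * k == i)); last exact: phi_lagrangeN0.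
  by exists l => //; apply/eqP.
by move=> m; exact: phi_lagrange0.
Qed.

Lemma phi_sep0 i k : ~ orbit i k -> phi k (sep i) = 0.
Proof.
move=> ik; rewrite phi_trace; last exact: lagrange_oi.
by apply: big1 => l _; apply: phi_lagrange0; apply/eqP => E; apply: ik; exists l.
Qed.

Definition orbit_size (i : 'F_p) : nat := if i == 0 then 1%N else d.

Lemma kap_fix i l : (kap ^+ l * i == i) = (orbit_size i %| l)%N.
Proof.
rewrite /orbit_size; case: (eqVneq i 0) => [->|i0]; first by rewrite mulr0 eqxx dvd1n.
by rewrite (prim_order_dvd kapP) -subr_eq0 -{2}[i]mul1r -mulrBl mulf_eq0 (negPf i0) orbF subr_eq0.
Qed.

Lemma orbit_size_dvd i : (orbit_size i %| p.-1)%N.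
Proof. by rewrite -kap_fix kap_order mul1r. Qed.

(** The order of the stabilizer of i in the group generated by [s]; it turns out to be the lam-adic
    valuation at i of a uniformizer of M. *)
Definition inertia (i : 'F_p) : nat := (p.-1 %/ orbit_size i)%N.

Lemma inertiaE i : (orbit_size i * inertia i)%N = p.-1.
Proof. by rewrite /inertia mulnC divnK ?orbit_size_dvd. Qed.

Lemma orbit_size_gt0 i : (0 < orbit_size i)%N.
Proof. by have := p1; rewrite -(inertiaE i) muln_gt0 => /andP[]. Qed.

Lemma inertia_gt0 i : (0 < inertia i)%N.
Proof. by have := p1; rewrite -(inertiaE i) muln_gt0 => /andP[]. Qed.

(* If x = lam^m y at the place i, the stabilizer s^c of i multiplies y by v^(cm), so either
   y vanishes at i or v^(cm) = 1. *)
Lemma near_M i x : OM x -> phi i x = 0 -> near i (inertia i) x.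
Proof.
move=> Mx x0; have /oi_M[Ox sx] := Mx.
have : (inertia i <= inertia i)%N by [].
elim: {1 3}(inertia i) => [|m IH] mi; first exact: near_oi.
have [a Oa [a0 [y Oy axy]]] := IH (ltnW mi).
suff y0 : phi i y = 0.
  have [b Ob [b0 [z Oz byz]]] := near1 Oy y0.
  exists (b * a); first exact: subringM.
  split; first by rewrite phiM // mulf_neq0.
  by exists z => //; rewrite -mulrA axy mulrCA byz expr1 mulrA -exprSr.
(* For exponent 0 the vanishing of y is that of x; the stabilizer would only compare y with v^0
   y. *)
case: m => [|m] in IH mi axy *.
  have := congr1 (phi i) axy; rewrite mul1r phiM // x0 mulr0 => <-.
  by [].
set c := orbit_size i; have [e Oe [lamE phie]] := iter_lam c.
have fixi z : OS z -> phi i (iter c s z) = phi i z.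
  by move=> Oz; rewrite phi_iter // (eqP (_ : kap ^+ c * i == i)) // kap_fix.
(* Apply [iter c s], which fixes x and the place i, to a x = lam^(m+1) y. The values of a and y at i
   do not change, while e^(m+1) takes the value v^(c(m+1)). *)
have E : a * e ^+ m.+1 * iter c s y = iter c s a * y.
  apply: (mulfI (expf_neq0 m.+1 lam0)).
  have := congr1 (iter c s) axy; rewrite !iterM iterX lamE (iter_M _ Mx) exprMn => E.
  have -> : lam ^+ m.+1 * (a * e ^+ m.+1 * iter c s y)
    = a * (lam ^+ m.+1 * e ^+ m.+1 * iter c s y) by ring.
  by rewrite -E [RHS]mulrCA -axy; ring.
have := congr1 (phi i) E; rewrite !phiM ?phiX ?fixi ?phie //; try exact: iter_oi;
  try exact: subringX; last by apply: subringM => //; exact: subringX.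
rewrite -mulrA => /(mulfI a0) /eqP.
rewrite -subr_eq0 -{2}[phi i y]mul1r -mulrBl mulf_eq0 subr_eq0 => /orP[|/eqP //].
(* If v^(c(m+1)) = 1, then p - 1 = c * inertia divides c(m+1), although m + 1 < inertia. *)
rewrite -exprM -(prim_order_dvd vP) => /dvdn_leq; rewrite muln_gt0 orbit_size_gt0 => /(_ isT).
by rewrite -(inertiaE i) leq_pmul2l ?orbit_size_gt0 // leqNgt mi.
Qed.

Definition prime_below (i : 'F_p) : set L := [set x | OM x /\ phi i x = 0].
Local Notation P := prime_below.

Lemma prime_below_ideal i : is_ideal M (P i).
Proof.
split; first by move=> x [].
- by split; [exact: subring0|exact: phi0].
- move=> x y [Mx x0] [My y0]; split; first exact: subringD.
  have /oi_M[Ox _] := Mx; have /oi_M[Oy _] := My.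
  by rewrite (placeD (phiP i)) // x0 y0 addr0.
- move=> a x Ma [Mx x0]; split; first exact: subringM.
  have /oi_M[Ox _] := Mx; have /oi_M[Oa _] := Ma.
  by rewrite phiM // x0 mulr0.
Qed.

Lemma prime_below_prime_over i : prime_over M p (P i).
Proof.
split.
  split; first exact: prime_below_ideal.
  - by move=> [_]; rewrite phi1 => /eqP; rewrite oner_eq0.
  - move=> x y Mx My [_]; have /oi_M[Ox _] := Mx; have /oi_M[Oy _] := My.
    by rewrite phiM // => /eqP; rewrite mulf_eq0 => /orP[]/eqP; [left|right].
move=> n; rewrite -Fp_int_eq0 // -(place_int (phiP i)); split=> [[_ ->]|/eqP n0] //.
by split=> //; exact: subring_int.
Qed.

Lemma prime_below_eq i k : P i = P k <-> orbit i k.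
Proof.
split=> [E|ik]; last first.
  by apply/seteqP; split=> x [Mx x0]; split=> //; rewrite -x0 (phi_orbit Mx ik).
apply: contrapT => ik; have : P k (sep i).
  by split; [exact: sep_M|exact: phi_sep0].
rewrite -E => -[_ /eqP]; apply/negP; apply: phi_sep.
by exists 0%N; rewrite mul1r.
Qed.

Lemma near_pM x : OM x -> (forall i, near i p.-1 x) -> multiples OM p%:R x.
Proof.
move=> Mx nx; have /oi_M[Ox _] := Mx.
have [y Oy xy] := near_global Ox nx.
exists (u * y); last by rewrite mulrA -lam_p.
split; last by case: (subringM sO uO Oy).
have p0 : p%:R != 0 :> L by have := expf_neq0 p.-1 lam0; rewrite lam_p mulf_eq0 negb_or => /andP[].
have -> : u * y = x / p%:R by apply: (canRL (mulfK p0)); rewrite xy lam_p; ring.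
by apply: rpred_div; [case: Mx|exact: rpred_nat].
Qed.

(** An inclusion of [P i] in [Q] is an equality, as the residue field at [P i] is F_p and [Q] meets
    Z in pZ. If [Q] is none of the [P i], each contains some x_i outside [Q]. The product of the x_i
    vanishes at all places, so its (p-1)-th power is divisible by p and lies in [Q], a
    contradiction. *)
Lemma prime_over_below (Q : set L) : prime_over M p Q -> exists i, Q = P i.
Proof.
move=> [[idQ Q1 Qprime] Qp]; apply: contrapT => nQ.
have /choice[x xP] : forall i, exists x, P i x /\ ~ Q x.
  move=> i; apply: contrapT => nx; apply: nQ; exists i.
  have PQ : P i `<=` Q by move=> x Px; apply: contrapT => Qx; apply: nx; exists x.
  apply/seteqP; split=> // y Qy; have My := idealO idQ Qy.
  have /oi_M[Oy _] := My; have Mn n := subring_nat sOM n; have On n := subring_nat sO n.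
  split=> //; apply/eqP; rewrite -[phi i y]FpK Fp_nat_eq0 //.
  suff : Q (phi i y : nat)%:R by move/(Qp (Posz (phi i y))).
  rewrite -[X in Q X](subKr y); apply: (idealB idQ) => //; apply: PQ.
  by split; [apply: (subringB sOM My); exact: Mn|rewrite phiB // phi_nat FpK subrr].
have Mx i : OM (x i) by case: (xP i) => -[].
have Ox i : OS (x i) by have /oi_M[] := Mx i.
have Qpow y n : OM y -> Q (y ^+ n) -> Q y.
  move=> My; elim: n => [|n IH]; first by rewrite expr0.
  by rewrite exprS => /Qprime[]//; exact: subringX.
have : Q (\prod_i x i).
  apply: (@Qpow _ p.-1); first exact: subring_prod.
  have [y My ->] : multiples OM p%:R ((\prod_i x i) ^+ p.-1).
    apply: near_pM => [|i]; first by apply: subringX => //; exact: subring_prod.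
    rewrite -[X in near i X]muln1; apply: nearX; apply: near1; first exact: subring_prod.
    rewrite phi_prod //; rewrite (bigD1 i) //=; case: (xP i) => -[_ ->] _.
    by rewrite mul0r.
  by apply: (idealMr idQ) => //; apply/(Qp p).
elim: (index_enum _) => [|i r IH]; first by rewrite big_nil.
rewrite big_cons => /Qprime[]//; first exact: subring_prod.
by case: (xP i).
Qed.

Lemma inertia_orbit i k : orbit i k -> inertia i = inertia k.
Proof.
move=> [l <-]; rewrite /inertia /orbit_size mulf_eq0 expf_eq0.
have -> : (kap == 0) = false; last by rewrite andbF.
apply/eqP => k0; have := prim_expr_order kapP.
by rewrite k0 expr0n eqn0Ngt (prim_order_gt0 kapP) => /eqP; rewrite eq_sym oner_eq0.
Qed.

Lemma exp_prime_below_near i k e x : orbit i k ->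
  exp_ideal M (P i) e x -> near k (e * inertia i) x.
Proof.
move=> ik; have /prime_below_eq -> := ik; rewrite (inertia_orbit ik).
elim: e x => [|e IH] x; first by move=> /oi_M[Ox _]; exact: near_oi.
apply: mul_ideal_sub => [|y z|y z [My y0] Ez]; first exact: near0.
  exact: nearD.
by rewrite mulSn; apply: nearM (IH _ Ez); exact: near_M.
Qed.

(* A uniformizer at the prime below i, nonzero at the places outside the orbit of i. *)
Definition uniformizer (i : 'F_p) : L :=
  trace (lam ^+ inertia i * lagrange i) + (1 - sep i ^+ p.-1) ^+ 2.

Let OS_unif_arg i : OS (lam ^+ inertia i * lagrange i).
Proof. by apply: subringM => //; exact: lagrange_oi. Qed.

Lemma cosep_M i : OM (1 - sep i ^+ p.-1).
Proof.
by apply: subringB => //; [exact: subring1|apply: subringX => //; exact: sep_M].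
Qed.

Lemma uniformizer_M i : OM (uniformizer i).
Proof.
by apply: subringD => //; [exact: trace_M|apply: subringX => //; exact: cosep_M].
Qed.

Lemma phi_cosep i k : phi k (1 - sep i ^+ p.-1) = 1 - phi k (sep i) ^+ p.-1.
Proof.
have /oi_M[Osep _] := sep_M i.
by rewrite phiB ?phi1 ?phiX //; [exact: subring1|exact: subringX].
Qed.

Lemma Fp_fermat (a : 'F_p) : a != 0 -> a ^+ p.-1 = 1.
Proof.
move=> a0; apply: (mulfI a0); rewrite -exprS mulr1 prednK ?prime_gt0 //.
by rewrite -[X in _ ^+ X](card_Fp p_pr) expf_card.
Qed.

Lemma phi_uniformizer0 i k : ~ orbit i k -> phi k (uniformizer i) = 1.
Proof.
move=> ik; have /oi_M[Oc _] := cosep_M i; have /oi_M[Ot _] := trace_M (OS_unif_arg i).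
rewrite (placeD (phiP k)) // ?phiX //; last exact: subringX.
rewrite phi_cosep phi_sep0 // expr0n eqn0Ngt p1 subr0 expr1n phi_trace // big1 ?add0r // => l _.
have Ol := lagrange_oi i.
by rewrite phiM // phiX // phi_lam expr0n eqn0Ngt inertia_gt0 mul0r.
Qed.

Lemma orbit_refl i : orbit i i.
Proof. by exists 0%N; rewrite mul1r. Qed.

(** The leading coefficient of the trace is a sum over l in which only the multiples of the orbit
    size survive at i. For these v^(l n) = 1, because orbit size times n is p - 1, so all surviving
    terms are equal and their number is nonzero modulo p. *)
Lemma uniformizer_local i : exists a z,
  [/\ OS a /\ phi i a != 0, OS z /\ phi i z != 0 & a * uniformizer i = lam ^+ inertia i * z].
Proof.
set n := inertia i; have n0 : (0 < n)%N := inertia_gt0 i.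
have Mc := cosep_M i; have /oi_M[Oc _] := Mc.
have c0 : phi i (1 - sep i ^+ p.-1) = 0.
  by rewrite phi_cosep Fp_fermat ?subrr //; exact/phi_sep/orbit_refl.
(* [1 - sep i ^+ p.-1] vanishes at i, hence has valuation at least n; its square has at least 2n > n
   and does not disturb the leading term. *)
have [a Oa [a0 [y Oy acy]]] := nearX 2 (near_M Mc c0).
have /choice[e eP] : forall l, exists e, [/\ OS e, iter l s lam = lam * e
    & forall i, phi i e = v%:R ^+ l].
  by move=> l; have [e Oe [? ?]] := iter_lam l; exists e.
have Oe l : OS (e l) by case: (eP l).
pose z1 := \sum_(l < p.-1) e l ^+ n * iter l s (lagrange i).
have Oz1l (l : nat) : OS (e l ^+ n * iter l s (lagrange i)).
  by apply: subringM => //; [exact: subringX|apply: iter_oi; exact: lagrange_oi].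
have Oz1 : OS z1 by exact: subring_sum.
exists a, (a * z1 + lam ^+ n * y); split=> //.
- split; first by apply: subringD => //; exact: subringM.
  rewrite (placeD (phiP i)) //; [|exact: subringM|exact: subringM].
  rewrite !phiM // phiX // phi_lam expr0n eqn0Ngt n0 mul0r addr0 mulf_neq0 //.
  rewrite phi_sum // (bigID (fun l : 'I_p.-1 => orbit_size i %| l)%N) /= [X in _ + X]big1.
    rewrite addr0 (eq_bigr (fun=> phi i (lagrange i))).
      by apply: (@sum_indicator (dvdn (orbit_size i))); [exists 0%N|exact: phi_lagrangeN0].
    move=> l cl; rewrite phiM ?phiX //; [|exact: subringX|by apply: iter_oi; exact: lagrange_oi].
    case: (eP l) => _ _ ->; rewrite -exprM.
    have /eqP -> : (v%:R : 'F_p) ^+ (l * n) == 1.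
      by have := dvdn_mul cl (dvdnn n); rewrite /n inertiaE (prim_order_dvd vP).
    rewrite mul1r phi_iter; last exact: lagrange_oi.
    by rewrite -kap_fix in cl; rewrite (eqP cl).
  move=> l cl; rewrite phiM ?phiX //; [|exact: subringX|by apply: iter_oi; exact: lagrange_oi].
  rewrite phi_iter; last exact: lagrange_oi.
  by rewrite phi_lagrange0 ?mulr0 // kap_fix.
- rewrite /uniformizer mulrDr acy mulrDr mulnC exprM expr2 [X in _ = _ + X]mulrA; congr (_ + _).
  rewrite mulrCA; congr (_ * _); rewrite /trace mulr_sumr; apply: eq_bigr => l _.
  by rewrite iterM iterX; case: (eP l) => _ -> _; rewrite exprMn mulrA.
Qed.

(* Writing P for the prime below i and e for its orbit size, the colon ideal C of p by P^e
   satisfies P^e C = p: the elements x with p x in P^e C form an ideal, and it contains an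
   element which vanishes at no place. *)
Lemma ramification_prime_below i : ramification_index M p (P i) (orbit_size i).
Proof.
set e := orbit_size i; have iP := prime_below_ideal i; have iPe n := exp_ideal_is_ideal n iP.
have Mp : OM p%:R by exact: subring_nat.
split; last first.
  move=> [C iC E]; apply: (@not_near_p i).
  have : principal_ideal M p%:R p%:R.
    by apply/principalP; exists 1; rewrite ?mulr1 //; exact: subring1.
  rewrite E; apply: mul_ideal_sub => [|y z|y z Ey Cz]; [exact: near0|exact: nearD|].
  have /oi_M[Oz _] := idealO iC Cz.
  have := nearM (exp_prime_below_near (orbit_refl i) Ey) (near_oi i Oz).
  (* (e + 1) * inertia = p - 1 + inertia is at least p, while p has valuation p - 1. *)
  apply: nearW; rewrite addn0 mulSn inertiaE -{1}(prednK (prime_gt0 p_pr)) -addn1 addnC.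
  by rewrite leq_add2r inertia_gt0.
pose C : set L := [set x | OM x /\ forall y, exp_ideal M (P i) e y -> multiples OM p%:R (y * x)].
have iC : is_ideal M C.
  split; first by move=> x [].
  - by split; [exact: subring0|move=> y _; rewrite mulr0; exact: multiples0].
  - move=> x y [Mx Cx] [My Cy]; split; first exact: subringD.
    by move=> z Ez; rewrite mulrDr; apply: multiplesD => //; [exact: Cx|exact: Cy].
  - move=> a x Ma [Mx Cx]; split; first exact: subringM.
    by move=> y Ey; rewrite mulrCA; apply: multiplesMl => //; exact: Cx.
have Cp : C p%:R.
  by split=> // y /(idealO (iPe e)) My; rewrite mulrC; exact: multiples_self.
exists C => //; apply/seteqP; split; last first.
  apply: mul_ideal_sub => [|x y /principalP px /principalP py|x y Ex [_ /(_ x Ex)]].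
  - by apply/principalP; exact: multiples0.
  - by apply/principalP; exact: multiplesD.
  - by move/principalP.
have iPC := mul_ideal_is_ideal (iPe e) iC.
pose J : set L := [set x | OM x /\ mul_ideal (exp_ideal M (P i) e) C (p%:R * x)].
have iJ : is_ideal M J.
  split; first by move=> x [].
  - by split; [exact: subring0|rewrite mulr0; exact: (ideal0 iPC)].
  - move=> x y [Mx Jx] [My Jy]; split; first exact: subringD.
    by rewrite mulrDr; exact: (idealD iPC).
  - move=> a x Ma [Mx Jx]; split; first exact: subringM.
    by rewrite mulrCA; exact: (idealMl iPC).
suff [_ J1] : J 1.
  move=> x /principalP[y My ->]; apply: (idealMr iPC) => //.
  by rewrite mulr1 in J1.
have EJ x : exp_ideal M (P i) e x -> J x.
  move=> Ex; split; first exact: (idealO (iPe e)).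
  by rewrite mulrC; exact: mul_ideal_mem.
have Mw := sep_M i; set w := sep i in Mw; have /oi_M[Ow _] := Mw.
(* On the orbit of i the factor y in P^e has valuation at least e * inertia = p - 1; elsewhere w
   vanishes, and its power contributes p - 1. *)
have Cw : C (w ^+ p.-1).
  split; first exact: subringX.
  move=> y Ey; have My := idealO (iPe e) Ey; have /oi_M[Oy _] := My.
  apply: near_pM => [|k]; first by apply: subringM => //; exact: subringX.
  have [ik|ik] := pselect (orbit i k).
    rewrite -[X in near k X]addn0; apply: nearM; last by apply: near_oi; exact: subringX.
    by rewrite -(inertiaE i); exact: exp_prime_below_near.
  rewrite -[X in near k X]add0n; apply: nearM; first exact: near_oi.
  rewrite -[X in near k X]muln1; apply: nearX; apply: near1 => //; exact: phi_sep0.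
have Mf := uniformizer_M i; have [a [z [[Oa a0] [Oz z0] fE]]] := uniformizer_local i.
set f := uniformizer i in Mf fE; have /oi_M[Of _] := Mf.
have Pf : P i f.
  split=> //; have := congr1 (phi i) fE; rewrite !phiM // phiX // phi_lam expr0n.
  rewrite eqn0Ngt inertia_gt0 mul0r => /eqP.
  by rewrite mulf_eq0 (negPf a0) => /eqP.
have Ef : exp_ideal M (P i) e (f ^+ e) by exact: exp_ideal_mem.
(* x1 = f^e w^(p-1) / p is nonzero at i, since f^e has valuation exactly p - 1 there and w is
   nonzero. *)
have [x1 Mx1 x1E] : multiples OM p%:R (f ^+ e * w ^+ p.-1) by case: Cw => _; exact.
have /oi_M[Ox1 _] := Mx1.
have Jx1 : J x1 by split=> //; rewrite -x1E; exact: mul_ideal_mem.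
have x10 : phi i x1 != 0.
  have E : a ^+ e * eps * x1 = z ^+ e * w ^+ p.-1.
    apply: (mulfI (expf_neq0 p.-1 lam0)).
    have -> : lam ^+ p.-1 * (a ^+ e * eps * x1) = a ^+ e * (p%:R * x1) by rewrite p_lam; ring.
    by rewrite -x1E mulrA -exprMn fE exprMn -exprM mulnC inertiaE mulrA.
  have := congr1 (phi i) E.
  have Oae : OS (a ^+ e) by exact: subringX.
  rewrite (phiM _ (subringM sO Oae epsO)) // (phiM _ (subringX sO e Oz) (subringX sO _ Ow)).
  rewrite !phiX // (Fp_fermat (phi_sep (orbit_refl i))) mulr1 => E'.
  by apply/eqP => x0; move: (expf_neq0 e z0); rewrite -E' x0 mulr0 eqxx.
have Ofx : OS (f ^+ e) /\ OS (x1 * w) by split; [exact: subringX|exact: subringM].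
(* f^e is 1 off the orbit of i and 0 on it; x1 w is nonzero on the orbit and, because of the factor
   w, 0 off it. *)
apply: (@ideal_unit M J e (f ^+ e + x1 * w) M_sub_S iJ).
- apply/EJ/exp_ideal_mem; split=> //.
  by rewrite phi_nat pchar_Fp_0.
- by apply: (idealD iJ); [exact: EJ|exact: (idealMr iJ)].
- move=> k; rewrite (placeD (phiP k)) ?phiX ?phiM //; try by case: Ofx.
  have [ik|ik] := pselect (orbit i k).
    rewrite -!(phi_orbit _ ik) //; case: Pf => _ ->.
    by rewrite expr0n eqn0Ngt orbit_size_gt0 add0r mulf_neq0 // phi_sep //; exact: orbit_refl.
  by rewrite phi_uniformizer0 // phi_sep0 // mulr0 addr0 expr1n oner_eq0.
Qed.

Lemma gen_neq0 n : (v%:R : 'F_p) ^+ n != 0.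
Proof.
apply: expf_neq0; apply/eqP => v0; have := prim_expr_order vP.
by rewrite v0 expr0n eqn0Ngt p1 => /eqP; rewrite eq_sym oner_eq0.
Qed.

(* Zero and the powers v^0, ..., v^((p-1)/d - 1) represent the orbits of kap on F_p. *)
Definition orbit_rep (j : nat) : 'F_p := if j is n.+1 then v%:R ^+ n else 0.

(** The d-th power map is constant on orbits, and v^(jd) determines j below (p-1)/d. *)
Lemma orbit_rep_inj j k : (j <= p.-1 %/ d)%N -> (k <= p.-1 %/ d)%N ->
  orbit (orbit_rep j) (orbit_rep k) -> j = k.
Proof.
have dp : (d %| p.-1)%N by rewrite (prim_order_dvd kapP) kap_order.
case: j k => [|j] [|k] //= jc kc [l /eqP].
- by rewrite mulf_eq0 (negPf (gen_neq0 _)) orbF expf_eq0 => /andP[_ /eqP k0]; have := kap_order;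
    rewrite k0 expr0n eqn0Ngt p1 => /eqP; rewrite eq_sym oner_eq0.
- by rewrite mulr0 eq_sym (negPf (gen_neq0 _)).
move=> /eqP /(congr1 (fun x => x ^+ d)).
have kd : kap ^+ l ^+ d = 1 by rewrite exprAC (prim_expr_order kapP) expr1n.
rewrite /= exprMn kd mul1r -!exprM => /eqP.
rewrite (eq_prim_root_expr vP) -(divnK dp) !modn_small ?ltn_pmul2r ?(prim_order_gt0 kapP) //.
by rewrite eqn_pmul2r ?(prim_order_gt0 kapP) // => /eqP->.
Qed.

Lemma orbit_rep_surj i : exists2 j, (j <= p.-1 %/ d)%N & orbit i (orbit_rep j).
Proof.
have dp : (d %| p.-1)%N by rewrite (prim_order_dvd kapP) kap_order.
case: (eqVneq i 0) => [->|i0]; first by exists 0%N => //; exact: orbit_refl.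
have [n ->] := prim_rootP vP (Fp_fermat i0).
have c0 : (0 < p.-1 %/ d)%N by rewrite divn_gt0 ?(prim_order_gt0 kapP) // dvdn_leq.
exists (n %% (p.-1 %/ d)).+1; first by rewrite ltn_mod.
(* Powers of v^((p-1)/d) are d-th roots of unity, hence powers of [kap]. *)
have [l lE] : {l : 'I_d | (v%:R : 'F_p) ^+ (n %/ (p.-1 %/ d) * (p.-1 %/ d)) = kap ^+ l}.
  apply: (prim_rootP kapP).
  by rewrite -exprM -mulnA divnK // mulnC exprM (prim_expr_order vP) expr1n.
by exists l; rewrite /= -lE -exprD -divn_eq.
Qed.

Theorem primes_of_M : exists P : 'I_(p.-1 %/ d).+1 -> set L,
  [/\ injective P, forall Q : set L, prime_over M p Q <-> exists j, Q = P j,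
      ramification_index M p (P ord0) 1
    & forall j, j != ord0 -> ramification_index M p (P j) d].
Proof.
exists (fun j => prime_below (orbit_rep j)); split.
- move=> j k /prime_below_eq /orbit_rep_inj jk; apply: val_inj; apply: jk; rewrite -ltnS; exact: ltn_ord.
- move=> Q; split=> [/prime_over_below[i ->]|[j ->]]; last exact: prime_below_prime_over.
  have [j jc ij] := orbit_rep_surj i; rewrite -ltnS in jc.
  by exists (Ordinal jc); apply/prime_below_eq.
- have := ramification_prime_below 0; by rewrite /orbit_size eqxx.
- move=> [[|j] jc] // _; have := ramification_prime_below (orbit_rep j.+1).
  by rewrite /orbit_size (negPf (gen_neq0 _)).
Qed.

End Places.

(** * Restriction, conjugation and construction of places *)

Lemma place_mono (L : splittingFieldType rat) (E F : {subfield L}) p (phi : L -> 'F_p) :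
  (E <= F)%VS -> place F phi -> place E phi.
Proof.
move=> EF [phi1 phiD phiM]; split=> // x y Ox Oy; [apply: phiD|apply: phiM];
  exact: (oi_sub EF).
Qed.

Lemma place_gal (L : splittingFieldType rat) (E : {subfield L}) p (phi : L -> 'F_p) (g : gal_of E) :
  place E phi -> place E (fun x => phi (g x)).
Proof.
move=> phiP; split; first by rewrite rmorph1; exact: place1 phiP.
  by move=> x y Ox Oy; rewrite rmorphD (placeD phiP) //; exact: oi_gal.
by move=> x y Ox Oy; rewrite rmorphM (placeM phiP) //; exact: oi_gal.
Qed.

Lemma multiples_is_ideal (L : splittingFieldType rat) (E : {subfield L}) a :
  ring_of_integers E a -> is_ideal E (multiples (ring_of_integers E) a).
Proof.
move=> Oa; have sO := oi_subring E; split.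
- by move=> _ [y Oy ->]; exact: subringM.
- exact: (multiples0 _ sO).
- by move=> x y; exact: (multiplesD sO).
- by move=> x y; exact: (multiplesMl sO).
Qed.

(** An integer representative modulo [I] is unique modulo p because [I] meets Z in pZ; this makes
    the chosen map a homomorphism. *)
Lemma place_of_ideal (L : splittingFieldType rat) (E : {subfield L}) p (I : set L) :
  prime p -> is_ideal E I -> I p%:R -> ~ I 1 ->
  (forall x, ring_of_integers E x -> exists n : int, I (x - n%:~R)) ->
  exists2 phi : L -> 'F_p, place E phi & forall x, ring_of_integers E x -> phi x = 0 <-> I x.
Proof.
move=> p_pr idI Ip I1 resI; have sO := oi_subring E.
have intP (n : int) : I n%:~R <-> (n%:~R : 'F_p) = 0.
  split=> [In|/eqP]; last first.
    rewrite Fp_int_eq0 // => /dvdzP[k ->]; rewrite rmorphM /=.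
    by apply: (idealMl idI) => //; exact: (subring_int sO).
  apply/eqP; rewrite Fp_int_eq0 //; apply: contrapT => pn; apply: I1.
  apply: (@ideal_int_coprime L E I idI p n) => //.
  by rewrite coprimezE /= prime_coprime //; apply/negP.
have /choice[n nP] : forall x, exists n : int, ring_of_integers E x -> I (x - n%:~R).
  by move=> x; have [/resI[n]|] := pselect (ring_of_integers E x); [exists n|exists 0].
have nE x m : ring_of_integers E x -> I (x - m%:~R) -> (n x)%:~R = m%:~R :> 'F_p.
  move=> Ox xm; apply/eqP; rewrite -subr_eq0 -rmorphB; apply/eqP/intP.
  have -> : (n x - m)%:~R = (x - m%:~R) - (x - (n x)%:~R) :> L by rewrite rmorphB /=; ring.
  by apply: (idealB idI) => //; exact: nP.
exists (fun x => (n x)%:~R); first split.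
- rewrite -[RHS]/(1%:~R); apply: nE; first exact: subring1.
  by rewrite subrr; exact: (ideal0 idI).
- move=> x y Ox Oy; rewrite -rmorphD; apply: nE; first exact: subringD.
  rewrite rmorphD /= [X in I X](_ : _ = (x - (n x)%:~R) + (y - (n y)%:~R)); last by ring.
  by apply: (idealD idI); exact: nP.
- move=> x y Ox Oy; rewrite -rmorphM; apply: nE; first exact: subringM.
  rewrite rmorphM /= [X in I X](_ : _ = (x - (n x)%:~R) * y
    + (n x)%:~R * (y - (n y)%:~R)); last by ring.
  apply: (idealD idI); first by apply: (idealMr idI) => //; exact: nP.
  by apply: (idealMl idI); [exact: (subring_int sO)|exact: nP].
- move=> x Ox; rewrite -intP -{2}[x](subrK (n x)%:~R); split=> H.
    by apply: (idealD idI) => //; exact: nP.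
  have -> : (n x)%:~R = (x - (n x)%:~R + (n x)%:~R) - (x - (n x)%:~R) by ring.
  by apply: (idealB idI) => //; exact: nP.
Qed.

Lemma Fp_frobenius p (a : 'F_p) : prime p -> a ^+ p = a.
Proof. by move=> p_pr; rewrite -[X in _ ^+ X](card_Fp p_pr) expf_card. Qed.

(** * Congruences modulo powers of lam *)

Section Congruences.
Variables (L : splittingFieldType rat) (p : nat) (zeta : L).
Hypotheses (p_pr : prime p) (p_odd : odd p) (zetaP : p.-primitive_root zeta).
Local Notation lam := (zeta - 1).
Local Notation K := (cyclotomic_field zeta).
Local Notation OK := (ring_of_integers K).
Let sO : is_subring OK := oi_subring K.
Let lamO : OK lam := lam_oi p_pr zetaP.
Let lam0 : lam != 0 := lam_neq0 p_pr zetaP.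
Let p1 : (0 < p.-1)%N. Proof. by rewrite -ltnS prednK ?prime_gt0 ?prime_gt1. Qed.

Lemma zeta_oi : OK zeta.
Proof. by split; [exact: zeta_K|exact: zeta_integral zetaP]. Qed.

Lemma residue_place : exists2 phi : L -> 'F_p, place K phi &
  forall x, OK x -> phi x = 0 <-> multiples OK lam x.
Proof.
have lp := multiples_oi p_pr zetaP (Zz_lam_p p_pr zetaP).
apply: place_of_ideal => //; last by move=> x; exact: (oi_residue p_pr zetaP).
- exact: multiples_is_ideal.
- by move/(@int_lam_dvd L p zeta K 1 p_pr zetaP);
    rewrite dvdzE /= dvdn1 => /eqP p1'; move: p_pr; rewrite p1'.
Qed.

(** The quotient (zeta^i - 1)/lam, congruent to i modulo lam. It measures the shift of (omega -
    1)/lam when omega is multiplied by zeta^i. *)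
Definition cyclo_quot (i : nat) : L := \sum_(j < i) zeta ^+ j.

Lemma cyclo_quotE i : zeta ^+ i - 1 = lam * cyclo_quot i.
Proof. exact: subrX1. Qed.

Lemma cyclo_quot_oi i : OK (cyclo_quot i).
Proof. by apply: subring_sum => // j _; apply: subringX => //; exact: zeta_oi. Qed.

Lemma place_lam (E : {subfield L}) (phi : L -> 'F_p) : (K <= E)%VS -> place E phi -> phi lam = 0.
Proof.
move=> KE /(place_mono KE) phiP.
have [u Zu lamE] := Zz_p_lam_pow p_pr zetaP; have Ou := Zz_oi p_pr zetaP Zu.
apply/eqP; rewrite -[_ == 0]andTb -p1 -expf_eq0 -(placeX phiP) // lamE.
by rewrite (placeM phiP) ?(place_nat phiP) ?pchar_Fp_0 ?mul0r //; exact: subring_nat.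
Qed.

Lemma place_zeta (E : {subfield L}) (phi : L -> 'F_p) : (K <= E)%VS -> place E phi -> phi zeta = 1.
Proof.
move=> KE phiP; rewrite -[zeta](subrK 1) (placeD phiP); last first.
- exact: subring1 (oi_subring E).
- exact: oi_sub lamO.
by rewrite (place_lam KE phiP) (place1 phiP) add0r.
Qed.

Lemma place_cyclo_quot (E : {subfield L}) (phi : L -> 'F_p) i : (K <= E)%VS -> place E phi ->
  phi (cyclo_quot i) = i%:R.
Proof.
move=> KE phiP; have phiPK := place_mono KE phiP.
rewrite (place_sum phiPK) => [|j]; last by apply: subringX => //; exact: zeta_oi.
rewrite (eq_bigr (fun=> 1)) => [|j _]; first by rewrite sumr_const card_ord.
by rewrite (placeX phiPK) ?(place_zeta KE phiP) ?expr1n //; exact: zeta_oi.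
Qed.

Lemma prod_sub_zeta x : \prod_(i < p) (x - zeta ^+ i) = x ^+ p - 1.
Proof.
have <- : ('X^p - 1 : {poly L}).[x] = x ^+ p - 1 by rewrite !hornerE.
rewrite -(factor_Xn_sub_1 zetaP) big_mkord horner_prod.
by apply: eq_bigr => i _; rewrite !hornerE.
Qed.

(* x^p - b^p is the product of the x - zeta^i b, all divisible by lam and one by lam^2. *)
Lemma expr_congr x (b : int) : OK x -> ~~ (p %| b)%Z -> multiples OK lam (x - b%:~R) ->
  multiples OK (lam ^+ p.+1) (x ^+ p - b%:~R ^+ p).
Proof.
move=> Ox pb [t Ot xE]; have [phi phiP phi0] := residue_place.
have b0 : (b%:~R : 'F_p) != 0 by rewrite Fp_int_eq0.
have bL : (b%:~R : L) != 0.
  apply/eqP => bL; move/eqP: b0; apply.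
  by rewrite -(place_int phiP) bL (place0 phiP).
have Ob : OK b%:~R by exact: subring_int.
have Of i : OK (t - cyclo_quot i * b%:~R).
  by apply: subringB => //; apply: subringM => //; exact: cyclo_quot_oi.
have -> : x ^+ p - b%:~R ^+ p = lam ^+ p * \prod_(i < p) (t - cyclo_quot i * b%:~R).
  have -> : x ^+ p - b%:~R ^+ p = b%:~R ^+ p * \prod_(i < p) (x / b%:~R - zeta ^+ i).
    rewrite prod_sub_zeta mulrBr mulr1 expr_div_n; congr (_ - _).
    by rewrite mulrC divfK // expf_neq0.
  have constp (c : L) : c ^+ p = \prod_(i < p) c by rewrite prodr_const card_ord.
  rewrite (constp b%:~R) (constp lam) -!big_split /=.
  apply: eq_bigr => i _; rewrite mulrBr [_ * (x / _)]mulrC divfK //.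
  have -> : x = lam * t + b%:~R by rewrite -xE subrK.
  by rewrite -[zeta ^+ i](subrK 1) cyclo_quotE; ring.
(* The index of the factor with a second lam: [cyclo_quot k] has residue k, so t - k b must vanish
   in the residue field. *)
pose k : 'F_p := phi t / b%:~R.
have kp : (k < p)%N by have := ltn_ord k; rewrite [X in (_ < X)%N](Fp_cast p_pr).
rewrite (bigD1 (Ordinal kp)) //= exprSr.
have [y Oy yE] : multiples OK lam (t - cyclo_quot k * b%:~R).
  apply/(phi0 _ (Of _)).
  rewrite (placeB phiP) // ?(placeM phiP) ?(place_cyclo_quot _ (subvv K) phiP) //;
    last by apply: subringM => //; exact: cyclo_quot_oi.
  2: exact: cyclo_quot_oi.
  by rewrite FpK (place_int phiP) divfK // subrr.
exists (y * \prod_(i < p | i != Ordinal kp) (t - cyclo_quot i * b%:~R)).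
  by apply: subringM => //; apply: subring_prod => // i _; exact: Of.
by rewrite yE !mulrA.
Qed.

Lemma place_residue (E : {subfield L}) (phi : L -> 'F_p) x (n : int) : (K <= E)%VS -> place E phi ->
  multiples OK lam (x - n%:~R) -> phi x = n%:~R.
Proof.
move=> KE phiE [y Oy xy]; have phiP := place_mono KE phiE.
rewrite -[x](subrK n%:~R) xy (placeD phiP) ?(placeM phiP) ?(place_int phiP) //.
- by rewrite (place_lam KE phiE) mul0r add0r.
- exact: subringM.
- exact: (subring_int sO).
Qed.

Lemma place_K_unique (E F : {subfield L}) (phi psi : L -> 'F_p) x : (K <= E)%VS -> (K <= F)%VS ->
  place E phi -> place F psi -> OK x -> phi x = psi x.
Proof.
move=> KE KF phiP psiP /(oi_residue p_pr zetaP)[n xn].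
by rewrite (place_residue KE phiP xn) (place_residue KF psiP xn).
Qed.

Section Jets.
Variable phi : L -> 'F_p.
Hypotheses (phiP : place K phi) (phi0 : forall x, OK x -> phi x = 0 <-> multiples OK lam x).

(** An expansion n + g lam^p modulo lam^(p+1) with a rational integer n. The coefficient g depends
    on x only, although n does not. *)
Definition jet (x : L) (n : int) (g : 'F_p) : Prop :=
  exists c, [/\ OK c, x = n%:~R + lam ^+ p * c & phi c = g].

Let Oint (n : int) : OK n%:~R. Proof. exact: (subring_int sO). Qed.
Let Olam n : OK (lam ^+ n). Proof. exact: subringX. Qed.

Let phi_lamp : phi (lam ^+ p) = 0.
Proof.
by rewrite (placeX phiP) // (place_lam (subvv K) phiP) expr0n eqn0Ngt prime_gt0.
Qed.

Lemma jetM x y n m g h : jet x n g -> jet y m h ->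
  jet (x * y) (n * m) (n%:~R * h + m%:~R * g).
Proof.
move=> [c [Oc -> <-]] [e [Oe -> <-]].
have Oce : OK (lam ^+ p * (c * e)) by apply: subringM => //; exact: subringM.
have Once : OK (n%:~R * e) by exact: subringM.
have Omc : OK (m%:~R * c) by exact: subringM.
exists (n%:~R * e + m%:~R * c + lam ^+ p * (c * e)); split.
- by do 2?apply: subringD.
- by rewrite rmorphM /=; ring.
- rewrite (placeD phiP) ?(placeD phiP) ?(placeM phiP) ?(place_int phiP) //;
    try exact: subringM; last exact: subringD.
  by rewrite phi_lamp mul0r addr0.
Qed.

Lemma jetX x n g k : jet x n g -> jet (x ^+ k.+1) (n ^+ k.+1) (k.+1%:R * n%:~R ^+ k * g).
Proof.
move=> jx; elim: k => [|k IH]; first by rewrite !expr1 expr0 !mul1r.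
rewrite exprS [n ^+ _]exprS; have := jetM jx IH; congr (jet _ _ _).
by rewrite rmorphXn /= exprS [k.+2%:R]mulrS; ring.
Qed.

(** sigma acts trivially on residues and multiplies lam^p by the p-th power of an element of residue
    v, and v^p = v in F_p. *)
Lemma jet_gal (sigma : gal_of K) v x n g : sigma zeta = zeta ^+ v ->
  jet x n g -> jet (sigma x) n (v%:R * g).
Proof.
move=> sz [c [Oc -> <-]].
have Oq := cyclo_quot_oi v; have Osc := oi_gal sigma Oc.
exists (cyclo_quot v ^+ p * sigma c); split.
- by apply: subringM => //; exact: subringX.
- rewrite rmorphD rmorphM rmorphXn rmorphB rmorph1 rmorph_int /= sz cyclo_quotE exprMn.
  by rewrite mulrA.
- rewrite (placeM phiP) ?(placeX phiP) //; last exact: subringX.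
  rewrite (place_cyclo_quot _ (subvv K) phiP) Fp_frobenius //.
  by rewrite (place_K_unique (subvv K) (subvv K) (place_gal sigma phiP) phiP Oc).
Qed.

(* A rational integer divisible by lam^p = p lam u is divisible by p^2, hence by lam^(p+1). *)
Lemma jet_unique x n m g h : jet x n g -> jet x m h -> g = h.
Proof.
move=> [c [Oc -> <-]] [e [Oe E <-]].
have [u Zu lamE] := Zz_p_lam_pow p_pr zetaP; have Ou := Zz_oi p_pr zetaP Zu.
have [w Zw pE] := Zz_lam_p p_pr zetaP; have Ow := Zz_oi p_pr zetaP Zw.
have lampE : lam ^+ p = p%:R * (u * lam).
  by rewrite -[X in lam ^+ X](prednK (prime_gt0 p_pr)) exprSr lamE mulrA.
have Oec : OK (e - c) by exact: subringB.
have nm : (n - m)%:~R = lam ^+ p * (e - c).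
  rewrite rmorphB mulrBr /=; apply/eqP; rewrite subr_eq [X in _ == X]addrC addrA -E; apply/eqP; ring.
have p0 : p%:Z != 0 by rewrite eqz_nat -lt0n prime_gt0.
have p0L : (p%:R : L) != 0.
  by have := expf_neq0 p.-1 lam0; rewrite lamE mulf_eq0 negb_or => /andP[].
have /dvdzP[k kE] : (p %| n - m)%Z.
  apply: (@integral_div_int L _ p (u * lam * (e - c))) => //.
    by case: (subringM sO (subringM sO Ou lamO) Oec).
  by rewrite nm lampE !mulrA.
have /dvdzP[j jE] : (p %| k)%Z.
  apply: (int_lam_dvd p_pr zetaP (E := K)); exists (u * (e - c)); first exact: subringM.
  apply: (mulfI p0L); rewrite mulrA [p%:R * lam]mulrC.
  have -> : p%:R * k%:~R = (n - m)%:~R :> L by rewrite kE rmorphM /= mulrC.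
  by rewrite nm lampE; ring.
have [eps [_ [Ze _ ppE _]]] := p_lam_pow p_pr zetaP; have Oeps := Zz_oi p_pr zetaP Ze.
(* The valuation 2(p-1) of p^2 exceeds p because p is at least 3. *)
have expE : (p.-1 + p.-1 = p + (p - 3).+1)%N.
  by case: p p_odd p_pr => [|[|[|q]]] // _ _; rewrite /= !subSS subn0 !addSn !addnS.
have ecE : e - c = lam * (lam ^+ (p - 3) * (eps ^+ 2 * j%:~R)).
  apply: (mulfI (expf_neq0 p lam0)); rewrite -nm kE jE !rmorphM /= -[p%:~R]/(p%:R).
  by rewrite mulrA -exprS mulrA -exprD -expE exprD {1 2}ppE expr2; ring.
apply/esym/eqP; rewrite -subr_eq0 -(placeB phiP) //; apply/eqP/phi0 => //.
rewrite ecE; apply: multiples_self; apply: (subringM sO (Olam _)).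
by apply: (subringM sO _ (Oint j)); exact: (subringX sO).
Qed.

Lemma jet_expr x (b : int) : OK x -> ~~ (p %| b)%Z -> multiples OK lam (x - b%:~R) ->
  jet (x ^+ p) (b ^+ p) 0.
Proof.
move=> Ox pb xb; have [y Oy yE] := expr_congr Ox pb xb.
exists (lam * y); split; first exact: subringM.
- by apply/eqP; rewrite addrC -subr_eq rmorphXn /= yE exprSr mulrA.
- by rewrite (placeM phiP) // (place_lam (subvv K) phiP) mul0r.
Qed.

Lemma jet0_congr x n : jet x n 0 -> multiples OK (lam ^+ p.+1) (x - n%:~R).
Proof.
move=> [c [Oc -> /(phi0 Oc)[y Oy ->]]]; exists y => //.
by rewrite exprSr; ring.
Qed.

(* Comparing the jets of both sides of beta^p = A^(mu (p-1)) sigma(A), where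
   beta = A^mu alpha, gives (v - mu) g = 0 for the jet coefficient g of A. *)
Lemma singular_jet0 (sigma : gal_of K) (v mu : nat) (A alpha : L) (a : int) :
  OK A -> ~ multiples OK lam A -> multiples OK (lam ^+ p) (A - a%:~R ^+ p) ->
  sigma zeta = zeta ^+ v -> alpha \in K -> sigma A = A ^+ mu * alpha ^+ p -> (0 < mu)%N ->
  (v%:R : 'F_p) != mu%:R -> ~~ (p %| a)%Z /\ jet A (a ^+ p) 0.
Proof.
move=> OA A_lam [c Oc AE] sz Kalpha sA mu0 vmu.
have jA : jet A (a ^+ p) (phi c).
  by exists c; split=> //; rewrite rmorphXn /= -AE addrC subrK.
have phiA : phi A = a%:~R.
  rewrite -[A](subrK (a%:~R ^+ p)) AE (placeD phiP); [|exact: subringM|exact: subringX].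
  rewrite (placeM phiP) // phi_lamp mul0r add0r (placeX phiP) // (place_int phiP).
  exact: Fp_frobenius.
have a0 : (a%:~R : 'F_p) != 0 by rewrite -phiA; apply/eqP => /(phi0 OA).
have pa : ~~ (p %| a)%Z by rewrite -Fp_int_eq0.
split=> //.
have aX k : (a%:~R : 'F_p) ^+ (k * p.-1) = 1.
  rewrite mulnC exprM (_ : _ ^+ p.-1 = 1) ?expr1n //.
  by apply: (mulfI a0); rewrite -exprS prednK ?prime_gt0 // Fp_frobenius // mulr1.
have OsA := oi_gal sigma OA.
(* [jetX] is stated for successor exponents, and N + 1 = mu (p-1) is -mu modulo p. *)
have [N NE] : exists N, (mu * p.-1)%N = N.+1.
  by exists (mu * p.-1).-1; rewrite prednK // muln_gt0 mu0 p1.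
(* alpha need not be integral, but beta is, since its p-th power A^(mu(p-1)) sigma(A) is. *)
pose beta := A ^+ mu * alpha.
have betaE : beta ^+ p = A ^+ N.+1 * sigma A.
  rewrite sA mulrA -exprD -NE -mulnSr prednK ?prime_gt0 //.
  by rewrite exprMn -exprM.
have Obeta : OK beta.
  split; first by apply: rpredM => //; apply: rpredX; case: OA.
  apply: (integral_monicXn (prime_gt0 p_pr) betaE).
  by case: (subringM sO (subringX sO N.+1 OA) OsA).
have [b bP] := oi_residue p_pr zetaP Obeta.
have pb : ~~ (p %| b)%Z.
  rewrite -Fp_int_eq0 // -(place_residue (subvv K) phiP bP).
  apply/eqP => b0; have := congr1 phi betaE.
  rewrite (placeX phiP) // b0 expr0n eqn0Ngt prime_gt0 // (placeM phiP) ?(placeX phiP) //;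
    last exact: subringX.
  rewrite (place_K_unique (subvv K) (subvv K) (place_gal sigma phiP) phiP OA) phiA -exprSr.
  by move/esym/eqP; rewrite expf_eq0 (negPf a0) andbF.
have := jetM (jetX N jA) (jet_gal sz jA); rewrite -betaE => /jet_unique/(_ (jet_expr Obeta pb bP)).
rewrite !rmorphXn /= !Fp_frobenius // => E.
have {E} E : (v%:R - mu%:R) * phi c = 0.
  have xN : (a%:~R : 'F_p) ^+ N.+1 = 1 by rewrite -NE aX.
  have N_mu : (N.+1%:R : 'F_p) = - mu%:R.
    rewrite -NE natrM -subn1 natrB ?prime_gt0 // pchar_Fp_0 // sub0r mulrN1 //.
  rewrite -{}[RHS]E xN N_mu; transitivity (v%:R * phi c - mu%:R * (a%:~R ^+ N.+1 * phi c)).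
    by rewrite xN; ring.
  by rewrite exprS; ring.
have : phi c = 0 by move/eqP: E; rewrite mulf_eq0 subr_eq0 (negPf vmu) => /eqP.
by move=> <-.
Qed.

(** A is congruent to a^p modulo lam^(p+1), so A^(p-1) is congruent to the p-th power of a^(p-1). As
    a^(p-1) is 1 modulo lam, that p-th power is 1 modulo lam^(p+1). *)
Lemma singular_congr (sigma : gal_of K) (v mu : nat) (A alpha : L) (a : int) :
  OK A -> ~ multiples OK lam A -> multiples OK (lam ^+ p) (A - a%:~R ^+ p) ->
  sigma zeta = zeta ^+ v -> alpha \in K -> sigma A = A ^+ mu * alpha ^+ p -> (0 < mu)%N ->
  (v%:R : 'F_p) != mu%:R -> multiples OK (lam ^+ p.+1) (A ^+ p.-1 - 1).
Proof.
move=> OA A_lam AE sz Kalpha sA mu0 vmu.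
have [pa jA] := singular_jet0 OA A_lam AE sz Kalpha sA mu0 vmu.
have a1 : multiples OK lam ((a ^+ p.-1)%:~R - 1%:~R).
  have -> : (a ^+ p.-1)%:~R - 1%:~R = (a ^+ p.-1 - 1)%:~R :> L by rewrite rmorphB.
  apply/(phi0 (Oint _)); rewrite (place_int phiP) rmorphB rmorphXn /=.
  apply/eqP; rewrite subr_eq0; apply/eqP; apply: (mulfI (_ : (a%:~R : 'F_p) != 0)).
    by rewrite Fp_int_eq0.
  by rewrite -exprS prednK ?prime_gt0 // Fp_frobenius // mulr1.
have p_1 : ~~ (p %| 1)%Z by rewrite dvdzE /= dvdn1 neq_ltn prime_gt1 ?orbT.
have j1 := jet_expr (Oint _) p_1 a1.
have := jetX p.-2 jA; rewrite mulr0 => jA'.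
have {}jA' : jet (A ^+ p.-1) ((a ^+ p) ^+ p.-1) 0.
  by move: jA'; rewrite (_ : p.-2.+1 = p.-1) //; case: (p) p1 => [|[]].
have := multiplesD sO (jet0_congr jA') (jet0_congr j1).
by rewrite expr1n exprAC !rmorphXn /= addrA subrK.
Qed.

End Jets.
End Congruences.

Lemma expr1D_congr (R : comNzRingType) (B : set R) n y : is_subring B -> B y ->
  exists2 z, B z & (1 + y) ^+ n = 1 + n%:R * y + y ^+ 2 * z.
Proof.
move=> sB By; elim: n => [|n [z Bz IH]].
  by exists 0; [exact: subring0|rewrite expr0 mul0r mulr0 !addr0].
exists (n%:R + z + y * z); last by rewrite exprS IH mulrS; ring.
by do ?[apply: subringD|apply: subringM] => //; exact: subring_nat.
Qed.

Lemma expr1D_prime (R : comNzRingType) (B : set R) p y : is_subring B -> prime p -> B y ->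
  exists2 z, B z & (1 + y) ^+ p = 1 + p%:R * y + p%:R * y ^+ 2 * z + y ^+ p.
Proof.
case: p => [|[|p]] // sB p_pr By.
exists (\sum_(i < p) ('C(p.+2, i.+2) %/ p.+2)%:R * y ^+ i).
  by apply: subring_sum => // i _; apply: subringM; [|exact: subring_nat|exact: subringX].
have -> : (1 + y) ^+ p.+2 = \sum_(i < p.+3) 'C(p.+2, i)%:R * y ^+ i.
  by rewrite exprDn; apply: eq_bigr => i _; rewrite expr1n mul1r mulr_natl.
rewrite big_ord_recr 2!big_ord_recl /= binn bin0 -[bump 0 0]/1%N bin1 mulr_sumr.
set s1 := (X in _ + (_ + X) + _ = _); set s2 := (X in _ = _ + X + _).
suff -> : s1 = s2 by rewrite expr0 expr1; ring.
apply: eq_bigr => i _; rewrite -[bump 0 (bump 0 i)]/i.+2.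
have /dvdnP[k ->] : (p.+2 %| 'C(p.+2, i.+2))%N by rewrite prime_dvd_bin //= !ltnS; exact: ltn_ord.
by rewrite mulnK // natrM exprS exprS; ring.
Qed.

Lemma integral_root_prod (F : fieldType) (n : nat) (c : 'I_n -> F) (t y : F) : (0 < n)%N ->
  (forall i, integralOver (intr : int -> F) (c i)) -> integralOver (intr : int -> F) y ->
  \prod_(i < n) (t - c i) = y -> integralOver (intr : int -> F) t.
Proof.
move=> n0 Ic Iy E; pose q : {poly F} := \prod_(i < n) ('X - (c i)%:P).
have qmon : q \is monic by apply: monic_prod => i _; exact: monicXsubC.
have szq : size q = n.+1 by rewrite size_prod_XsubC -[index_enum _]enumT size_enum_ord.
apply: (integral_root_monic (p := q - y%:P)).
- rewrite monicE lead_coefDl ?(monicP qmon) // size_polyN szq.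
  by apply: leq_ltn_trans (size_polyC_leq1 y) _; rewrite ltnS.
- rewrite rootE !hornerE horner_prod -E subr_eq0; apply/eqP/eq_bigr => i _.
  by rewrite !hornerE.
- apply/integral_poly => i; rewrite coefB coefC; apply: integral_sub; last first.
    by case: eqP => // _; exact: integral0.
  pose Z : set F := [set x | integralOver (intr : int -> F) x].
  have sZ : is_subring Z.
    by split; [exact: integral1|move=> ? ?; exact: integral_sub|move=> ? ?; exact: integral_mul].
  have sP := poly_coef_subring sZ.
  move: i; apply: (subring_prod sP) => i _; apply: (subringB sP) => k.
    by rewrite coefX; exact: (subring_nat sZ).
  by rewrite coefC; case: eqP => _; [exact: Ic|exact: (subring0 sZ)].
Qed.

Lemma AEnd_eq_1 (L : splittingFieldType rat) (f g : 'AEnd(L)) : {in 1%VS, f =1 g}.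
Proof. by move=> _ /vlineP[k ->]; rewrite !linearZ /= !rmorph1. Qed.

Lemma AEnd_eq_adjoin (L : splittingFieldType rat) (E : {subfield L}) (f g : 'AEnd(L)) t :
  {in E, f =1 g} -> f t = g t -> {in <<E; t>>%VS, f =1 g}.
Proof.
move=> fg ft _ /Fadjoin_polyP[q /polyOverP Eq ->].
rewrite -!horner_map /= ft; congr (_.[_]); apply/polyP => i.
by rewrite !coef_map /= fg.
Qed.

Lemma gal_iter (L : splittingFieldType rat) (E : {subfield L}) (g : gal_of E) l x :
  x \in E -> (g ^+ l)%g x = iter l g x.
Proof.
move=> Ex; elim: l => [|l IH]; first by rewrite expg0 gal_id.
by rewrite expgSr galM // IH.
Qed.

Lemma Fp_nat_eq p m n : prime p -> (m%:R : 'F_p) = n%:R -> (m == n %[mod p])%N.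
Proof. by move=> p_pr /(congr1 val) /=; rewrite !val_Fp_nat // => ->. Qed.

(** * The Kummer extension *)

Section Kummer.
Variables (L : splittingFieldType rat) (p v mu : nat) (zeta : L).
Local Notation lam := (zeta - 1).
Local Notation K := (cyclotomic_field zeta).
Local Notation OK := (ring_of_integers K).
Variables (sigma : gal_of K) (A gamma r omega : L).
Local Notation S := (kummer_extension zeta r).
Local Notation OS := (ring_of_integers S).
Variable s : gal_of S.
Hypotheses (p_pr : prime p) (zetaP : p.-primitive_root zeta).
Hypothesis vP : (p.-1).-primitive_root (v%:R : 'F_p).
Hypotheses (sz : sigma zeta = zeta ^+ v) (OA : OK A) (A0 : A != 0).
Hypothesis A_congr : multiples OK (lam ^+ p.+1) (A ^+ p.-1 - 1).
Hypothesis rK : r \notin K.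
Hypotheses (rE : r ^+ p = A) (omegaE : omega ^+ p = A ^+ p.-1).
Hypotheses (sK : {in K, s =1 sigma}) (Kgamma : gamma \in K).
Hypothesis s_omega : s omega = omega ^+ mu * gamma.
Hypothesis gamma1 : exists a,
  [/\ OK a, ~ multiples OK lam a & multiples OK (lam ^+ 2) (a * (gamma - 1))].
Hypothesis mu0 : (mu%:R : 'F_p) != 0.

Let sOK : is_subring OK := oi_subring K.
Let sO : is_subring OS := oi_subring S.
Let lamO : OK lam := lam_oi p_pr zetaP.
Let lam0 : lam != 0 := lam_neq0 p_pr zetaP.
Let p1 : (0 < p.-1)%N. Proof. by rewrite -ltnS prednK ?prime_gt0 ?prime_gt1. Qed.

Lemma K_sub_S : (K <= S)%VS. Proof. exact: subv_adjoin. Qed.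
Let OKS x : OK x -> OS x. Proof. exact: (oi_sub K_sub_S). Qed.

Definition tau : L := (omega - 1) / lam.

Lemma omega_tau : omega = 1 + lam * tau.
Proof. by rewrite /tau mulrC divfK // addrC subrK. Qed.

(** omega^p - 1 is the product of the omega - zeta^i, that is, lam^p times the present product. A
    congruence modulo lam^p would only make tau integral; the additional lam makes some factor
    vanish modulo each prime over lam. *)
Lemma prod_tau : multiples OK lam (\prod_(i < p) (tau - cyclo_quot zeta i)).
Proof.
have [c Oc E] := A_congr; exists c => //; apply: (mulfI (expf_neq0 p lam0)).
rewrite mulrA -exprSr -E -omegaE -(prod_sub_zeta zetaP).
have constp (x : L) : x ^+ p = \prod_(i < p) x by rewrite prodr_const card_ord.
rewrite constp -big_split /=; apply: eq_bigr => i _.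
by rewrite mulrBr -cyclo_quotE omega_tau; ring.
Qed.

Lemma tau_integral : integralOver (intr : int -> L) tau.
Proof.
have [c Oc E] := prod_tau.
apply: (integral_root_prod (prime_gt0 p_pr) _ _ E).
  by move=> i; case: (cyclo_quot_oi p_pr zetaP i).
by case: (subringM sOK lamO Oc).
Qed.

Lemma r_omega : exists i, omega * r = A * zeta ^+ i.
Proof.
have : (omega * r / A) ^+ p = 1.
  rewrite expr_div_n exprMn rE omegaE -exprSr prednK ?prime_gt0 // divff //.
  by rewrite expf_neq0.
by move=> /(prim_rootP zetaP)[i E]; exists i; rewrite -E [RHS]mulrC divfK.
Qed.

Lemma omega0 : omega != 0.
Proof.
apply/eqP => o0; have /eqP := omegaE; rewrite o0 expr0n eqn0Ngt prime_gt0 //= eq_sym.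
by rewrite expf_eq0 (negPf A0) andbF.
Qed.

Lemma S_eq : S = <<K; tau>>%AS :> {vspace L}.
Proof.
have [i E] := r_omega; have KA : A \in K by case: OA.
have Kz := zeta_K zeta; have Klam : lam \in K by rewrite rpredB // mem1v.
apply/eqP; rewrite eqEsubv; apply/andP; split; apply/FadjoinP; split; try exact: subv_adjoin.
  have -> : r = A * zeta ^+ i / omega by rewrite -E mulrAC divff ?mul1r // omega0.
  have KT := subvP (subv_adjoin K tau); rewrite omega_tau.
  apply: rpred_div; first by apply: rpredM; [|apply: rpredX]; exact: KT.
  by apply: rpredD; [exact: rpred1|apply: rpredM; [exact: KT|exact: memv_adjoin]].
have KT := subvP (subv_adjoin K r).
have r0 : r != 0 by apply/eqP => r0; move: rK; rewrite r0 mem0v.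
have -> : tau = (A * zeta ^+ i / r - 1) / lam by rewrite -E mulfK.
apply: rpred_div; last exact: KT.
apply: rpredB; last exact: rpred1.
apply: rpred_div; last exact: memv_adjoin.
by apply: rpredM; [|apply: rpredX]; exact: KT.
Qed.

Lemma tau_oi : OS tau.
Proof. by split; [rewrite S_eq memv_adjoin|exact: tau_integral]. Qed.

(** Divide (1 + lam tau)^p = A^(p-1) by lam^p: the linear term gives eps tau, congruent to -tau, and
    the other middle terms keep a factor lam. *)
Lemma tau_frobenius : multiples (adjoin OK tau) lam (tau ^+ p - tau).
Proof.
have sC := adjoin_subring tau sOK; have OC := adjoin_base tau sOK.
have Ct := adjoin_gen tau sOK; have Cl := OC _ lamO.
have [eps [w [Ze Zw pE epsE]]] := p_lam_pow p_pr zetaP.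
have Ce := OC _ (Zz_oi p_pr zetaP Ze); have Cw := OC _ (Zz_oi p_pr zetaP Zw).
have [z Cz] := expr1D_prime sC p_pr (subringM sC Cl Ct).
rewrite -omega_tau omegaE; have [c Oc Ac] := A_congr.
rewrite -[A ^+ p.-1](subrK 1) Ac => E; have Cc := OC _ Oc.
exists (c - w * tau - eps * tau ^+ 2 * z).
  apply: (subringB sC); first by apply: (subringB sC) => //; exact: (subringM sC).
  by apply: (subringM sC) => //; apply: (subringM sC) => //; exact: (subringX sC).
have lampE : lam ^+ p = lam ^+ p.-1 * lam by rewrite -exprSr prednK ?prime_gt0.
apply: (mulfI (expf_neq0 p lam0)); rewrite mulrBr -exprMn.
have -> : (lam * tau) ^+ p = lam ^+ p.+1 * c - p%:R * (lam * tau) - p%:R * (lam * tau) ^+ 2 * z.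
  apply: (addrI (1 + p%:R * (lam * tau) + p%:R * (lam * tau) ^+ 2 * z)).
  by rewrite -E; ring.
rewrite exprSr lampE pE epsE; ring.
Qed.

Lemma adjoin_frobenius x : adjoin OK tau x -> multiples (adjoin OK tau) lam (x ^+ p - x).
Proof.
have OC := adjoin_base tau sOK.
have OCm y a : multiples OK a y -> multiples (adjoin OK tau) a y.
  by move=> [w Ow ->]; exists w => //; exact: OC.
apply: (frobenius_adjoin sOK p_pr _ _ tau_frobenius) => //.
  by apply: OCm; apply: (multiples_oi p_pr zetaP); exact: Zz_lam_p.
by move=> y /(oi_frobenius p_pr zetaP); exact: OCm.
Qed.

Lemma S_localized x : OS x -> localized (adjoin OK tau) p x.
Proof.
move=> [Sx Ix]; have OC := adjoin_base tau sOK.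
have OCm y a : multiples OK a y -> multiples (adjoin OK tau) a y.
  by move=> [w Ow ->]; exists w => //; exact: OC.
apply: (integral_localized (adjoin_subring tau sOK) p_pr lam0 _ _ adjoin_frobenius (k := p.-1)) => //.
- exact: OC.
- by apply: OCm; apply: (multiples_oi p_pr zetaP); exact: Zz_lam_p.
- by apply: OCm; apply: (multiples_oi p_pr zetaP); exact: Zz_p_lam_pow.
- apply: (adjoin_denominator (E := K)) => //; last by rewrite -S_eq.
  move=> y /(Zz_denominator)[n n0 Zn]; exists n; split=> //.
  exact: (Zz_oi p_pr zetaP Zn).
Qed.

Lemma adjoin_sub_OS : adjoin OK tau `<=` OS.
Proof. by apply: (adjoin_min sO OKS); exact: tau_oi. Qed.

Lemma S_frobenius x : OS x -> multiples OS lam (x ^+ p - x).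
Proof.
move=> Ox.
have OCm y a : multiples OK a y -> multiples (adjoin OK tau) a y.
  by move=> [w Ow ->]; exists w => //; exact: adjoin_base.
have lp : multiples (adjoin OK tau) lam p%:R.
  by apply: OCm; apply: (multiples_oi p_pr zetaP); exact: Zz_lam_p.
have [b [m cm Cb] E] := localized_frobenius (adjoin_subring tau sOK) p_pr lam0 lp
  adjoin_frobenius (S_localized Ox).
exists b => //.
have [w Cw pE] := lp; have Ow := adjoin_sub_OS Cw.
have Opb : OS (p%:R * b).
  rewrite pE mulrAC -E; apply: subringM => //; apply: subringB => //; exact: subringX.
have /coprimezP[[c e] /= ce] : coprimez p m by rewrite coprimezE.
(* b = (x^p - x)/lam lies in O_S because p b and m b do and m is prime to p. *)
have -> : b = c%:~R * (p%:R * b) + e%:~R * (m%:R * b).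
  have : (c * p + e * m)%:~R = 1 :> L by rewrite ce.
  rewrite rmorphD !rmorphM /= -[p%:~R]/(p%:R) -[m%:~R]/(m%:R) => H.
  by rewrite !mulrA -mulrDl H mul1r.
apply: subringD => //; apply: subringM => //; try exact: (subring_int sO).
exact: adjoin_sub_OS.
Qed.

Let lamOS : OS lam. Proof. exact: OKS. Qed.

(** * Places of S *)

Lemma exists_maximal_ideal : exists m : set L, [/\ is_ideal S m, m p%:R, ~ m 1 &
  forall I, is_ideal S I -> m `<=` I -> ~ I 1 -> I = m].
Proof.
pose P : set (set L) := [set X | X = set0 \/ [/\ is_ideal S X, X p%:R & ~ X 1]].
have [F FP totF|m [mP mmax]] := @Zorn_bigcup L P.
  have [[X0 FX0 [x0 Xx0]]|F0] := pselect (exists2 X, F X & X !=set0); last first.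
    left; apply/seteqP; split=> // x [X FX Xx]; case: F0; exists X => //.
    by exists x.
  have idF X x : F X -> X x -> [/\ is_ideal S X, X p%:R & ~ X 1].
    by move=> /FP[->|] //.
  right; split; last by move=> [X FX X1]; case: (idF _ _ FX X1).
    split.
    - by move=> x [X FX Xx]; case: (idF _ _ FX Xx) => iX _ _; exact: (idealO iX).
    - by exists X0 => //; case: (idF _ _ FX0 Xx0) => iX _ _; exact: (ideal0 iX).
    - move=> x y [X FX Xx] [Y FY Yy].
      have [iX _ _] := idF _ _ FX Xx; have [iY _ _] := idF _ _ FY Yy.
      case: (totF _ _ FX FY) => XY.
        by exists Y => //; apply: (idealD iY) => //; exact: XY.
      by exists X => //; apply: (idealD iX) => //; exact: XY.
    - move=> a x Oa [X FX Xx]; exists X => //.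
      by case: (idF _ _ FX Xx) => iX _ _; exact: (idealMl iX).
  by exists X0 => //; case: (idF _ _ FX0 Xx0).
have pO : P (multiples OS p%:R).
  right; split; first by apply: multiples_is_ideal; exact: subring_nat.
    by exists 1; [exact: subring1|rewrite mulr1].
  move=> [y [_ Iy] E].
  have : (p %| 1)%Z by apply: (integral_div_int (L := L) (y := y)) => //;
    rewrite eqz_nat -lt0n prime_gt0.
  by rewrite dvdzE /= dvdn1 => /eqP p1'; move: p_pr; rewrite p1'.
have pp : multiples OS p%:R p%:R by exists 1; [exact: subring1|rewrite mulr1].
case: mP => [m0|[im mp m1]].
  case: (mmax (multiples OS p%:R)) => //; rewrite m0 properEneq; split=> //.
  by apply/eqP => E; move: pp; rewrite -E.
exists m; split=> // I iI mI I1; apply: contrapT => Im.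
apply: (mmax I); last by right; split=> //; exact: mI.
by rewrite properEneq; split=> //; apply/eqP => E; exact: Im.
Qed.

(** A maximal ideal m over p contains lam, so elements of O_K have integer residues. Being prime, m
    contains a factor of [prod_tau], so tau has one too, and the localization extends this to
    O_S. *)
Lemma exists_place : exists phi : L -> 'F_p, place S phi.
Proof.
have [m [im mp m1 mmax]] := exists_maximal_ideal.
have mprime x y : OS x -> OS y -> m (x * y) -> m x \/ m y.
  move=> Ox Oy mxy; have [mx|mx] := pselect (m x); [by left|right].
  pose I : set L := [set z | exists a b, [/\ m a, OS b & z = a + x * b]].
  have iI : is_ideal S I.
    split.
    - by move=> _ [a [b [ma Ob ->]]]; apply: subringD => //; [exact: (idealO im)|exact: subringM].
    - by exists 0, 0; split; [exact: (ideal0 im)|exact: subring0|rewrite mulr0 addr0].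
    - move=> _ _ [a [b [ma Ob ->]]] [c [e [mc Oe ->]]]; exists (a + c), (b + e).
      by split; [exact: (idealD im)|exact: subringD|ring].
    - move=> k _ Ok [a [b [ma Ob ->]]]; exists (k * a), (k * b).
      by split; [exact: (idealMl im)|exact: subringM|ring].
  have mI : m `<=` I by move=> a ma; exists a, 0; split=> //; [exact: subring0|rewrite mulr0 addr0].
  have [a [b [ma Ob ab]]] : I 1.
    apply: contrapT => I1; apply: mx; rewrite -(mmax _ iI mI I1).
    by exists 0, 1; split; [exact: (ideal0 im)|exact: subring1|rewrite mulr1 add0r].
  have -> : y = a * y + b * (x * y) by rewrite -[LHS]mul1r ab; ring.
  by apply: (idealD im); [exact: (idealMr im)|exact: (idealMl im)].
have mlam : m lam.
  have [u Zu lamE] := Zz_p_lam_pow p_pr zetaP.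
  have : m (lam ^+ p.-1).
    by rewrite lamE; apply: (idealMr im) => //; apply: OKS; exact: (Zz_oi p_pr zetaP Zu).
  elim: p.-1 => [//|n IH]; rewrite exprS => /mprime[]//.
  exact: subringX.
have mK x : OK x -> exists n : int, m (x - n%:~R).
  move=> /(oi_residue p_pr zetaP)[n [y Oy E]]; exists n.
  by rewrite E; apply: (idealMr im) => //; exact: OKS.
pose B : set L := [set x | OS x /\ exists n : int, m (x - n%:~R)].
have sB : is_subring B.
  split; first by split; [exact: subring1|exists 1; rewrite subrr; exact: (ideal0 im)].
  - move=> x y [Ox [n xn]] [Oy [k yk]]; split; first exact: subringB.
    exists (n - k); have := idealB im xn yk; congr (m _); rewrite rmorphB /=; ring.
  - move=> x y [Ox [n xn]] [Oy [k yk]]; split; first exact: subringM.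
    exists (n * k); have On : OS n%:~R by exact: (subring_int sO).
    have := idealD im (idealMr im Oy xn) (idealMl im On yk).
    by congr (m _); rewrite rmorphM /=; ring.
have Btau : B tau.
  split; first exact: tau_oi.
  have Oi i : OS (tau - cyclo_quot zeta i).
    by apply: subringB => //; [exact: tau_oi|apply: OKS; exact: (cyclo_quot_oi p_pr zetaP)].
  have : m (\prod_(i < p) (tau - cyclo_quot zeta i)).
    have [c Oc ->] := prod_tau; apply: (idealMr im) => //; exact: OKS.
  elim: (index_enum _) => [|i l IH]; first by rewrite big_nil.
  rewrite big_cons => /mprime[]//; first exact: subring_prod.
  move=> mi; have [n mn] := mK _ (cyclo_quot_oi p_pr zetaP i).
  by exists n; have := idealD im mi mn; rewrite addrA subrK.
have BC : adjoin OK tau `<=` B.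
  by apply: (adjoin_min sB) => // x Ox; split; [exact: OKS|exact: mK].
have [|phi phiP _] := place_of_ideal p_pr im mp m1; last by exists phi.
move=> x Ox; have [k ck /BC[_ [n kn]]] := S_localized Ox.
have /coprimezP[[c e] /= ce] : coprimez p k by rewrite coprimezE.
exists (e * n).
have -> : x - (e * n)%:~R = e%:~R * (k%:R * x - n%:~R) + c%:~R * x * p%:R.
  have : (c * p + e * k)%:~R = 1 :> L by rewrite ce.
  rewrite rmorphD !rmorphM /= -[p%:~R]/(p%:R) -[k%:~R]/(k%:R) => H.
  by rewrite -{1}[x]mul1r -{1}H; ring.
apply: (idealD im); apply: (idealMl im) => //; last apply: subringM => //;
  exact: (subring_int sO).
Qed.

Lemma place_tau_unique (phi psi : L -> 'F_p) : place S phi -> place S psi ->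
  phi tau = psi tau -> forall x, OS x -> phi x = psi x.
Proof.
move=> phiP psiP E x Ox.
pose B : set L := [set y | OS y /\ phi y = psi y].
have sB : is_subring B.
  split; first by split; [exact: subring1|rewrite (place1 phiP) (place1 psiP)].
  - move=> y z [Oy yE] [Oz zE]; split; first exact: subringB.
    by rewrite (placeB phiP) // (placeB psiP) // yE zE.
  - move=> y z [Oy yE] [Oz zE]; split; first exact: subringM.
    by rewrite (placeM phiP) // (placeM psiP) // yE zE.
have BC : adjoin OK tau `<=` B.
  apply: (adjoin_min sB); last by split; [exact: tau_oi|].
  move=> y Oy; split; first exact: OKS.
  exact: (place_K_unique p_pr zetaP K_sub_S K_sub_S phiP psiP Oy).
have [k ck /BC[_]] := S_localized Ox.
have Ok : OS k%:R by exact: subring_nat.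
rewrite (placeM phiP) // (placeM psiP) // (place_nat phiP) (place_nat psiP).
by apply: mulfI; rewrite Fp_nat_eq0 // -prime_coprime.
Qed.

(** * The Galois group of S over Q *)

Lemma zeta_exp_eq m n : (m%:R : 'F_p) = n%:R -> zeta ^+ m = zeta ^+ n.
Proof. by move=> mn; apply/eqP; rewrite (eq_prim_root_expr zetaP); exact: Fp_nat_eq. Qed.

Lemma zeta_S : zeta \in S.
Proof. by case: (OKS (zeta_oi p_pr zetaP)). Qed.

Lemma KA : A \in K. Proof. by case: OA. Qed.

Lemma omega_S : omega \in S.
Proof.
rewrite omega_tau; apply: rpredD; first exact: rpred1.
by apply: rpredM; [case: lamOS|case: tau_oi].
Qed.

Lemma s_iter_zeta l : iter l s zeta = zeta ^+ (v ^ l).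
Proof.
elim: l => [|l IH] /=; first by rewrite expn0 expr1.
by rewrite IH rmorphXn /= sK ?zeta_K // sz -exprM expnS.
Qed.

Lemma AEnd_iter (f : 'AEnd(L)) : exists l, {in K, f =1 (s ^+ l)%g}.
Proof.
have : f zeta ^+ p = 1 by rewrite -rmorphXn /= (prim_expr_order zetaP) rmorph1.
move=> /(prim_rootP zetaP)[a fz].
have a0 : (a%:R : 'F_p) != 0.
  rewrite Fp_nat_eq0 //; apply/negP => pa.
  have za1 : zeta ^+ a = 1 by apply/eqP; rewrite -(prim_order_dvd zetaP).
  have : f zeta = f 1 by rewrite fz za1 rmorph1.
  by move=> /fmorph_inj z1; move: lam0; rewrite z1 subrr eqxx.
have : (a%:R : 'F_p) ^+ p.-1 = 1.
  by apply: (mulfI a0); rewrite -exprS prednK ?prime_gt0 // Fp_frobenius // mulr1.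
move=> /(prim_rootP vP)[l al]; exists l.
apply: AEnd_eq_adjoin; first exact: AEnd_eq_1.
by rewrite gal_iter ?zeta_S // s_iter_zeta fz; apply: zeta_exp_eq; rewrite natrX.
Qed.

Lemma AEnd_omega (f g : 'AEnd(L)) : {in K, f =1 g} -> exists i, f omega = zeta ^+ i * g omega.
Proof.
move=> fg; have g0 : g omega != 0 by rewrite fmorph_eq0 omega0.
have : (f omega / g omega) ^+ p = 1.
  rewrite expr_div_n -!rmorphXn /= omegaE fg ?rpredX ?KA // divff //.
  by rewrite fmorph_eq0 expf_neq0.
by move=> /(prim_rootP zetaP)[i E]; exists i; rewrite -E divfK.
Qed.

Lemma AEnd_eq_S (f g : 'AEnd(L)) : {in K, f =1 g} -> f omega = g omega -> {in S, f =1 g}.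
Proof.
move=> fg fo; apply: AEnd_eq_adjoin => //.
have [i E] := r_omega; apply: (mulfI (_ : f omega != 0)); first by rewrite fmorph_eq0 omega0.
rewrite {2}fo -!rmorphM /= E; apply: fg.
by apply: rpredM; [exact: KA|apply: rpredX; exact: zeta_K].
Qed.

(** This is normality of S over Q, not only over K. On K, f is a power of s, and f(omega) differs
    from the image of omega under that power by a p-th root of unity, as their p-th powers agree. *)
Lemma AEnd_S (f : 'AEnd(L)) x : x \in S -> f x \in S.
Proof.
have [l fl] := AEnd_iter f; have [i fo] := AEnd_omega fl.
have Ko := subvP K_sub_S.
have fS y : y \in K -> f y \in S by move=> Ky; rewrite fl // memv_gal // Ko.
have foS : f omega \in S.
  by rewrite fo rpredM ?rpredX ?zeta_S // memv_gal // omega_S.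
have frS : f r \in S.
  have [j E] := r_omega.
  have -> : f r = f (A * zeta ^+ j) / f omega.
    by apply: (canRL (mulfK _)); rewrite ?fmorph_eq0 ?omega0 // -rmorphM /= mulrC E.
  apply: rpred_div foS; apply: fS.
  by apply: rpredM; [exact: KA|apply: rpredX; exact: zeta_K].
move=> /Fadjoin_polyP[q /polyOverP Kq ->]; rewrite -horner_map.
by apply: rpred_horner => //; apply/polyOverP => k; rewrite coef_map /=; exact: (fS _ (Kq k)).
Qed.

Lemma S_galois : galois 1 S.
Proof.
apply/and3P; split; first exact: sub1v.
  apply/separableP => x _; apply: pcharf0_separable => q.
  by rewrite pchar_lalg Num.Theory.pchar_num.
apply/forall_inP => f _; rewrite -dimv_leqif_eq; last first.
  by apply/subvP => _ /memv_imgP[x Sx ->]; exact: AEnd_S.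
by rewrite limg_dim_eq // (eqP (AEnd_lker0 f)) capv0.
Qed.

(** g(tau) = zeta^i tau + (zeta^i - 1)/lam, where the coefficient has residue 1 and the constant
    residue i. *)
Lemma gal_K_tau (phi : L -> 'F_p) (g : gal_of S) i : place S phi -> {in K, g =1 id} ->
  g omega = zeta ^+ i * omega -> phi (g tau) = phi tau + i%:R.
Proof.
move=> phiP gK go.
have -> : g tau = zeta ^+ i * tau + cyclo_quot zeta i.
  have goE : g omega = 1 + lam * g tau.
    by rewrite {1}omega_tau rmorphD rmorphM rmorph1 /= (gK lam) //; case: lamO.
  apply: (mulfI lam0); apply: (addrI 1); rewrite -goE go mulrDr -cyclo_quotE omega_tau; ring.
have Oz : OS (zeta ^+ i) by apply: subringX => //; apply: OKS; exact: (zeta_oi p_pr zetaP).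
have Oq : OS (cyclo_quot zeta i) by apply: OKS; exact: (cyclo_quot_oi p_pr zetaP).
rewrite (placeD phiP) //; last by apply: subringM => //; exact: tau_oi.
rewrite (placeM phiP) //; last exact: tau_oi.
rewrite (placeX phiP); last by apply: OKS; exact: (zeta_oi p_pr zetaP).
by rewrite (place_zeta p_pr zetaP K_sub_S phiP) expr1n mul1r
  (place_cyclo_quot p_pr zetaP _ K_sub_S phiP).
Qed.

Lemma exists_theta : exists (g : gal_of S) i, [/\ {in K, g =1 id},
  g omega = zeta ^+ i * omega & (i%:R : 'F_p) != 0].
Proof.
have galKS : galois K S by apply: galoisS S_galois; rewrite sub1v K_sub_S.
have [g gG gr] : exists2 g, g \in 'Gal(S / K)%g & g r != r.
  apply: contrapT => nfix; move/negP: rK; apply; rewrite -(galois_fixedField galKS).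
  apply/fixedFieldP; first exact: memv_adjoin.
  by move=> g gG; apply/eqP; apply: contrapT => /negP gr; apply: nfix; exists g.
have gK : {in K, g =1 id} by move=> x Kx; exact: fixed_gal K_sub_S gG Kx.
have [i go] : exists i, g omega = zeta ^+ i * omega.
  have [|i] := @AEnd_omega g \1%AF; first by move=> x Kx; rewrite gK // id_lfunE.
  by rewrite id_lfunE; exists i.
exists g, i; split=> //; apply/eqP => i0; move/eqP: gr; apply.
have go1 : g omega = \1%AF omega.
  by rewrite go (zeta_exp_eq (n := 0)) ?expr0 ?mul1r ?id_lfunE.
have gid : {in K, g =1 \1%AF} by move=> x Kx; rewrite gK // id_lfunE.
by rewrite (AEnd_eq_S gid go1) ?id_lfunE // memv_adjoin.
Qed.

Lemma v_neq0 : (v%:R : 'F_p) != 0.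
Proof.
apply/eqP => v0; have := prim_expr_order vP.
by rewrite v0 expr0n eqn0Ngt p1 => /eqP; rewrite eq_sym oner_eq0.
Qed.

(** Compare the coefficients of lam in s(omega) = omega^mu gamma: v s(tau) on the left and mu tau on
    the right, as gamma is 1 modulo lam^2. The factor a clears the denominator of gamma - 1. *)
Lemma phi_s_tau (phi : L -> 'F_p) : place S phi ->
  phi (s tau) = mu%:R / v%:R * phi tau.
Proof.
move=> phiP; have [a [Oa a_lam [q Oq aE]]] := gamma1.
have Ot := tau_oi; have Oaf := OKS Oa; have Oqf := OKS Oq.
have [z Oz zE] := expr1D_congr mu sO (subringM sO lamOS Ot).
have Oh : OS (cyclo_quot zeta v) by apply: OKS; exact: (cyclo_quot_oi p_pr zetaP).
have Ost := oi_gal s Ot.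
pose e := tau ^+ 2 * z * a + (1 + mu%:R * (lam * tau) + (lam * tau) ^+ 2 * z) * q.
have Olt : OS (lam * tau) by exact: subringM.
have O2 n y : OS y -> OS (n%:R * y) by move=> Oy; apply: (subringM sO) => //; exact: subring_nat.
have Oe : OS e.
  apply: (subringD sO).
    by apply: (subringM sO) => //; apply: (subringM sO) => //; exact: subringX.
  apply: (subringM sO) => //; apply: (subringD sO); last first.
    by apply: (subringM sO) => //; exact: subringX.
  by apply: (subringD sO); [exact: subring1|exact: O2].
have E : a * cyclo_quot zeta v * s tau = a * (mu%:R * tau) + lam * e.
  have so : s omega = 1 + lam * cyclo_quot zeta v * s tau.
    rewrite {1}omega_tau rmorphD rmorphM rmorph1 rmorphB rmorph1 /= sK ?zeta_K //.
    by rewrite sz cyclo_quotE.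
  apply: (mulfI lam0); apply: (addrI a).
  have -> : a + lam * (a * cyclo_quot zeta v * s tau) = a * s omega by rewrite so; ring.
  rewrite s_omega {1}omega_tau zE.
  have ag : a * gamma = a + lam ^+ 2 * q by rewrite -aE; ring.
  by rewrite mulrCA ag /e; ring.
have phia : phi a != 0.
  have [psi psiP psi0] := residue_place p_pr zetaP.
  rewrite (place_K_unique p_pr zetaP K_sub_S (subvv K) phiP psiP Oa).
  by apply/eqP => /(psi0 _ Oa).
have Oam : OS (a * (mu%:R * tau)) by apply: (subringM sO) => //; exact: O2.
have Ole : OS (lam * e) by exact: (subringM sO).
have Oah : OS (a * cyclo_quot zeta v) by exact: (subringM sO).
have Omt := O2 mu _ Ot; have Omu : OS mu%:R by exact: subring_nat.
have := congr1 phi E; rewrite (placeD phiP) // (placeM phiP Oah Ost) (placeM phiP Oaf Oh).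
rewrite (placeM phiP Oaf Omt).
rewrite (placeM phiP Omu Ot) (placeM phiP lamOS Oe).
rewrite (place_lam p_pr zetaP K_sub_S phiP) mul0r addr0 (place_nat phiP).
rewrite (place_cyclo_quot p_pr zetaP _ K_sub_S phiP) -mulrA => /(mulfI phia) E'.
by rewrite mulrAC -E' mulrC mulKf // v_neq0.
Qed.

Let kap : 'F_p := mu%:R / v%:R.

Lemma phi_iter_tau (phi : L -> 'F_p) l : place S phi ->
  phi (iter l s tau) = kap ^+ l * phi tau.
Proof.
elim: l phi => [|l IH] phi phiP; first by rewrite mul1r.
have := IH _ (place_gal s phiP); rewrite -iterS => ->.
by rewrite phi_s_tau // mulrA exprSr.
Qed.

(** s^(p-1) is trivial on K, so it multiplies omega by some zeta^i and shifts the value of tau by i.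
    But it also multiplies this value by kap^(p-1) = 1, whence i = 0. *)
Lemma s_order x : x \in S -> iter p.-1 s x = x.
Proof.
move=> Sx; have [phi phiP] := exists_place.
have sS y : y \in S -> (s ^+ p.-1)%g y = iter p.-1 s y by exact: gal_iter.
have Ko := subvP K_sub_S.
have gK : {in K, (s ^+ p.-1)%g =1 \1%AF}.
  apply: AEnd_eq_adjoin; first exact: AEnd_eq_1.
  rewrite sS ?zeta_S // s_iter_zeta id_lfunE -[RHS]expr1; apply: zeta_exp_eq.
  by rewrite natrX (prim_expr_order vP).
have gK' : {in K, (s ^+ p.-1)%g =1 id} by move=> y Ky; rewrite gK // id_lfunE.
have [i go] := AEnd_omega gK; rewrite id_lfunE in go.
have i0 : (i%:R : 'F_p) = 0.
  apply: (addrI (phi tau)); rewrite addr0 -(gal_K_tau phiP gK' go).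
  have [St _] := tau_oi; rewrite sS // phi_iter_tau // expr_div_n.
  have kp : kap != 0 by rewrite mulf_neq0 // invr_eq0 v_neq0.
  rewrite -expr_div_n (_ : _ ^+ p.-1 = 1) ?mul1r //.
  by apply: (mulfI kp); rewrite -exprS prednK ?prime_gt0 // Fp_frobenius // mulr1.
have go1 : (s ^+ p.-1)%g omega = \1%AF omega.
  by rewrite go (zeta_exp_eq (n := 0)) ?expr0 ?mul1r ?id_lfunE.
by rewrite -sS // (AEnd_eq_S gK go1) // id_lfunE.
Qed.

Lemma exists_place_tau (j : 'F_p) : exists phi : L -> 'F_p, place S phi /\ phi tau = j.
Proof.
have [phi phiP] := exists_place; have [g [i [gK go i0]]] := exists_theta.
suff H k : exists psi : L -> 'F_p, place S psi /\ psi tau = phi tau + k%:R * i%:R.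
  have [psi [psiP E]] := H ((j - phi tau) / i%:R : 'F_p); exists psi; split=> //.
  by rewrite E FpK divfK // addrC subrK.
elim: k => [|k [psi [psiP E]]]; first by exists phi; rewrite mul0r addr0.
exists (fun x => psi (g x)); split; first exact: place_gal.
by rewrite (gal_K_tau psiP gK go) E mulrS mulrDl mul1r -addrA [X in _ + X]addrC.
Qed.

(** n is the norm of x; its residue is the product of the values of x at the conjugate places, all
    nonzero. *)
Lemma S_norm x : OS x -> (forall phi : L -> 'F_p, place S phi -> phi x != 0) ->
  exists2 y, OS y & exists2 n : int, x * y = n%:~R & ~~ (p %| n)%Z.
Proof.
move=> Ox x0; have [phi phiP] := exists_place.
pose y := \prod_(g in 'Gal(S / 1)%g | g != 1%g) g x.
have Oy : OS y by apply: subring_prod => // g _; exact: oi_gal.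
have xy : x * y = galNorm 1 S x.
  by rewrite /galNorm (bigD1 1%g) ?group1 //= gal_id.
have O_N : OS (x * y) by exact: subringM.
have [n nE] : exists n : int, x * y = n%:~R.
  apply: integral_rat; last by case: O_N.
  by rewrite xy; apply: mem_galNorm; [exact: S_galois|case: Ox].
exists y => //; exists n => //.
rewrite -Fp_int_eq0 // -(place_int phiP) -nE xy /galNorm (place_prod phiP); last first.
  by move=> g; exact: oi_gal.
by apply/prodf_neq0 => g _; exact: (x0 _ (place_gal g phiP)).
Qed.

(** * The field M *)

Local Notation Om := (Omega_elt p omega s).
Local Notation M := (singular_Q_field p omega s).

Lemma Omega_iter : Om = \sum_(i < p.-1) iter i s omega.
Proof. by apply: eq_bigr => i _; rewrite gal_iter // omega_S. Qed.

Lemma s_Omega : s Om = Om.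
Proof.
rewrite Omega_iter; have := s_order omega_S.
case: (p.-1) p1 => // q _ sq; rewrite rmorph_sum /= big_ord_recr big_ord_recl /=.
by rewrite -[s (iter q s omega)]/(iter q.+1 s omega) sq addrC.
Qed.

Lemma iter_omega l : exists2 k, k \in K & iter l s omega = omega ^+ (mu ^ l) * k.
Proof.
elim: l => [|l [k Kk E]]; first by exists 1; rewrite ?rpred1 // mulr1 expr1.
exists (gamma ^+ (mu ^ l) * s k).
  by rewrite rpredM ?rpredX // sK // memv_gal.
by rewrite /= E rmorphM rmorphXn /= s_omega exprMn -exprM expnS mulrA.
Qed.

Lemma sum_zeta m : \sum_(j < p) zeta ^+ (m * j) = if (p %| m)%N then p%:R else 0.
Proof.
case: ifP => pm.
  rewrite (eq_bigr (fun=> 1)) => [|j _]; first by rewrite sumr_const card_ord.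
  by apply/eqP; rewrite -(prim_order_dvd zetaP) dvdn_mulr.
have m1 : zeta ^+ m - 1 != 0 by rewrite subr_eq0 -(prim_order_dvd zetaP) pm.
apply: (mulfI m1); rewrite mulr0 (eq_bigr (fun j : 'I_p => (zeta ^+ m) ^+ j)) => [|j _].
  by rewrite -subrX1 -exprM mulnC exprM (prim_expr_order zetaP) expr1n subrr.
by rewrite exprM.
Qed.

(* Averaging over the powers of g isolates the component of Omega along the K-line of omega,
   a sum of terms all congruent to 1 at every place, hence nonzero. *)
Lemma Omega_stabilizer (g : gal_of S) k : {in K, g =1 id} -> g omega = zeta ^+ k * omega ->
  g Om = Om -> (k%:R : 'F_p) = 0.
Proof.
move=> gK go gOm; apply/eqP; apply: contrapT => /negP k0.
(* The weights zeta^(k(p-1)j) select the i with k(mu^i - 1) = 0 modulo p; p - 1 stands for -1 in a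
   natural exponent. *)
pose e i := (k * (mu ^ i + p.-1))%N.
have giter i j : iter j g (iter i s omega) = zeta ^+ (k * mu ^ i * j) * iter i s omega.
  elim: j => [|j IH]; first by rewrite muln0 mul1r.
  rewrite /= IH rmorphM /= gK; last by rewrite rpredX ?zeta_K.
  have [c Kc cE] := iter_omega i; rewrite cE rmorphM rmorphXn /= (gK c Kc) go exprMn -exprM.
  by rewrite mulnS exprD; ring.
have gOmj j : iter j g Om = Om by elim: j => //= j ->.
have T0 : \sum_(i < p.-1 | (p %| e i)%N) iter i s omega = 0.
  have pL : (p%:R : L) != 0.
    have [u _ lamE] := Zz_p_lam_pow p_pr zetaP.
    by have := expf_neq0 p.-1 lam0; rewrite lamE mulf_eq0 negb_or => /andP[].
  apply: (mulfI pL); rewrite mulr0.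
  transitivity (\sum_(j < p) zeta ^+ (k * p.-1 * j) * iter j g Om); last first.
    under eq_bigr do rewrite gOmj.
    rewrite -mulr_suml sum_zeta Euclid_dvdM // -Fp_nat_eq0 // (negPf k0) /=.
    by rewrite gtnNdvd // ?mul0r // -[X in (_ < X)%N](prednK (prime_gt0 p_pr)).
  have iterOm j : iter j g Om = \sum_(i < p.-1) iter j g (iter i s omega).
    by rewrite Omega_iter; elim: j => //= j ->; rewrite rmorph_sum.
  under [RHS]eq_bigr do rewrite iterOm mulr_sumr.
  rewrite exchange_big /= mulr_sumr big_mkcond /=; apply: eq_bigr => i _.
  under eq_bigr => j _.
    rewrite giter mulrA -exprD -mulnDl -mulnDr addnC -/(e i).
  over.
  by rewrite -mulr_suml sum_zeta; case: ifP; rewrite ?mul0r.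
have [phi phiP] := exists_place.
have Oo : OS omega.
  rewrite omega_tau; apply: (subringD sO); first exact: subring1.
  by apply: (subringM sO) => //; exact: tau_oi.
have Oiter i : OS (iter i s omega) by elim: i => //= i; exact: oi_gal.
have phio (psi : L -> 'F_p) : place S psi -> psi omega = 1.
  move=> psiP; rewrite omega_tau (placeD psiP); [|exact: subring1|exact: subringM tau_oi].
  by rewrite (placeM psiP lamOS tau_oi) (place_lam p_pr zetaP K_sub_S psiP) mul0r addr0 (place1 psiP).
have phii i (psi : L -> 'F_p) : place S psi -> psi (iter i s omega) = 1.
  elim: i psi => [|i IH] psi psiP; first exact: phio.
  exact: (IH _ (place_gal s psiP)).
have := congr1 phi T0; rewrite (place_sum phiP) // (place0 phiP).
rewrite (eq_bigr (fun=> 1)) => [|i _]; last exact: phii.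
(* There are at most p - 1 terms, and at least one because e 0 = k p. *)
rewrite sumr_const => /eqP; rewrite Fp_nat_eq0 //; apply/negP; rewrite gtnNdvd //.
  apply/card_gt0P; exists (Ordinal p1); rewrite unfold_in /e /= expn0 add1n prednK ?prime_gt0 //.
  exact: dvdn_mull.
by rewrite -[X in (_ < X)%N](prednK (prime_gt0 p_pr)) ltnS -[X in (_ <= X)%N]card_ord max_card.
Qed.

(** By the Galois correspondence it suffices that every g fixing Omega is a power of s. With h
    trivial on K and g = h s^l, also h fixes Omega, and [Omega_stabilizer] gives h = 1. *)
Lemma M_fixed x : x \in M <-> x \in S /\ s x = x.
Proof.
have Om_S : Om \in S.
  by rewrite Omega_iter; apply: rpred_sum => i _; rewrite -gal_iter ?memv_gal ?omega_S.
have MS : (M <= S)%VS by apply/FadjoinP; split; [exact: sub1v|].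
split=> [Mx|[Sx sx]].
  split; first exact: (subvP MS).
  have sOm : s Om = \1%AF Om by rewrite id_lfunE s_Omega.
  by rewrite (@AEnd_eq_adjoin L 1%AS s \1%AF Om (AEnd_eq_1 _ _) sOm x Mx) id_lfunE.
have galMS : galois M S by apply: galoisS S_galois; rewrite sub1v MS.
rewrite -(galois_fixedField galMS); apply/fixedFieldP => // g gG.
have gOm : g Om = Om by apply: fixed_gal gG _ => //; exact: memv_adjoin.
have [l gl] := AEnd_iter g.
pose h := (g * (s ^+ l)^-1)%g.
have gh y : y \in S -> g y = (s ^+ l)%g (h y).
  by move=> Sy; rewrite -galM ?memv_gal // /h mulgKV.
have hK : {in K, h =1 id}.
  move=> y Ky; have Sy := subvP K_sub_S _ Ky.
  by rewrite /h galM // gl // -galM // mulgV gal_id.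
have sl y : y \in S -> s y = y -> (s ^+ l)%g y = y.
  by move=> Sy sy; rewrite gal_iter //; elim: l {gl h gh hK} => //= l ->.
have slV y : y \in S -> s y = y -> ((s ^+ l)^-1)%g y = y.
  by move=> Sy sy; rewrite -{1}(sl y Sy sy) -galM // mulgV gal_id.
have hOm : h Om = Om by rewrite /h galM // gOm slV // s_Omega.
have hK1 : {in K, h =1 \1%AF} by move=> y Ky; rewrite id_lfunE hK.
have [k ho] := AEnd_omega hK1; rewrite id_lfunE in ho.
have k0 := Omega_stabilizer hK ho hOm.
have ho1 : h omega = \1%AF omega.
  by rewrite ho (zeta_exp_eq (n := 0)) ?expr0 ?mul1r ?id_lfunE.
by rewrite gh // (AEnd_eq_S hK1 ho1) // id_lfunE sl.
Qed.

Theorem primes_of_singular_Q_field d : d.-primitive_root (mu%:R / v%:R : 'F_p) ->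
  exists P : 'I_(p.-1 %/ d).+1 -> set L,
    [/\ injective P, forall Q : set L, prime_over M p Q <-> exists j, Q = P j,
        ramification_index M p (P ord0) 1
      & forall j, j != ord0 -> ramification_index M p (P j) d].
Proof.
move=> kapP; have /choice[phi phiP] := exists_place_tau.
have phiS i : place S (phi i) by case: (phiP i).
have phit i : phi i tau = i by case: (phiP i).
have [eps [_ [Ze _ pE _]]] := p_lam_pow p_pr zetaP.
have [u Zu lamE] := Zz_p_lam_pow p_pr zetaP.
apply: (primes_of_M (lam := lam) (eps := eps) (u := u) (eta := cyclo_quot zeta v) (t := tau)
  (kap := kap) (phi := phi) (s := s) (v := v)) => //.
- by apply: OKS; exact: (Zz_oi p_pr zetaP Ze).
- by apply: OKS; exact: (Zz_oi p_pr zetaP Zu).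
- exact: S_frobenius.
- exact: tau_oi.
- move=> i; apply: place_tau_unique => //; first exact: place_gal.
  by rewrite phi_s_tau // !phit.
- by apply: OKS; exact: (cyclo_quot_oi p_pr zetaP).
- by rewrite rmorphB rmorph1 /= sK ?zeta_K // sz cyclo_quotE.
- by move=> i; exact: (place_cyclo_quot p_pr zetaP _ K_sub_S (phiS i)).
- exact: M_fixed.
- exact: s_order.
- move=> x Ox x0; apply: S_norm => // psi psiP.
  have := x0 (psi tau); rewrite (place_tau_unique (phiS _) psiP) //.
Qed.

End Kummer.

(** * Application to singular data *)

Lemma exp_principal_ideal (L : splittingFieldType rat) (E : {subfield L}) a n x :
  ring_of_integers E a -> exp_ideal E (principal_ideal E a) n x ->
  multiples (ring_of_integers E) (a ^+ n) x.
Proof.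
move=> Oa; have sO := oi_subring E; elim: n x => [|n IH] x.
  by move=> Ox; exists x; rewrite ?expr0 ?mul1r.
apply: mul_ideal_sub => [|y z|y z /principalP[c Oc ->] /IH[e Oe ->]].
- exact: (multiples0 _ sO).
- exact: (multiplesD sO).
- by exists (c * e); [exact: (subringM sO)|rewrite exprS mulrACA].
Qed.

(** k is 2m or 2m + 1. The strict bounds keep mu distinct from v modulo p, which is needed both for
    the congruence on A and for d > 1. *)
Lemma singular_data_exponent (L : splittingFieldType rat) (p v mu : nat) (zeta : L)
  (sigma cc : gal_of (cyclotomic_field zeta)) (A alpha : L) : odd p ->
  singular_data p v sigma cc mu A alpha ->
  [/\ alpha \in cyclotomic_field zeta, sigma A = A ^+ mu * alpha ^+ p,
      ~ pth_power_in_K p zeta A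
    & exists2 k, (1 < k < p.-1)%N & (mu = v ^ k %[mod p])%N].
Proof.
move=> p_odd.
move=> [[m [m_bnd data]]|[m [m_bnd data]]|[m [m_bnd [AK _ nA [alphaK sA] [muE _]]]]].
- have [G [I [_ [[_ nA _] _] _ [Kalpha sA] [muE _]]]] := data.
  by split=> //; exists (2 * m + 1)%N => //; lia.
- have [G [I [_ [[_ nA _] _] _ [Kalpha sA] [muE _]]]] := data.
  by split=> //; exists (2 * m)%N => //; lia.
- split=> //; last by exists (2 * m)%N => //; lia.
  by case: alphaK => _ [Kp _] _; exact: (subvP (fixedField_bound _)) Kp.
Qed.

Theorem theorem6p5 (L : splittingFieldType rat) (p v mu d : nat) (zeta : L)
  (sigma cc : gal_of (cyclotomic_field zeta))
  (A alpha r omega : L)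
  (sigma_mu : gal_of (kummer_extension zeta r)) :
  prime p -> odd p -> p.-primitive_root zeta ->
  (p.-1).-primitive_root (v%:R : 'F_p) ->
  sigma zeta = zeta ^+ v ->
  cc zeta = zeta^-1 ->
  (1 <= mu <= p.-1)%N ->
  singular_data p v sigma cc mu A alpha ->
  primary p zeta A ->
  r ^+ p = A ->
  omega ^+ p = A ^+ p.-1 ->
  is_sigma_mu p mu alpha omega sigma sigma_mu ->
  d.-primitive_root (v%:R * (mu%:R)^-1 : 'F_p) ->
  let M := singular_Q_field p omega sigma_mu in
  (1 < d)%N /\
  exists P : 'I_(p.-1 %/ d).+1 -> set L,
    [/\ injective P,
        forall Q : set L, prime_over M p Q <-> exists j, Q = P j,
        ramification_index M p (P ord0) 1
      & forall j, j != ord0 -> ramification_index M p (P j) d].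
Proof.
move=> p_pr p_odd zetaP vP sz _ /andP[mu_gt0 mu_lt] data [OA A_pi [a Aa]] rE omegaE.
move=> [sK [w [_ s_omega [b [Ob b_pi gamma1]]]]] dP M.
have [Kalpha sA nA [k /andP[k1 kp] muE]] := singular_data_exponent p_odd data.
have lamO := lam_oi p_pr zetaP; have [phi phiP phi0] := residue_place p_pr zetaP.
have A_lam : ~ multiples (ring_of_integers (cyclotomic_field zeta)) (zeta - 1) A.
  by move=> /principalP.
have mu0 : (mu%:R : 'F_p) != 0.
  by rewrite Fp_nat_eq0 // gtnNdvd // -[X in (_ < X)%N](prednK (prime_gt0 p_pr)).
have vmu : (v%:R : 'F_p) != mu%:R.
  have -> : (mu%:R : 'F_p) = v%:R ^+ k.
    by apply: val_inj; rewrite -natrX /= !val_Fp_nat.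
  rewrite -[X in X != _]expr1 (eq_prim_root_expr vP) !modn_small //; first by rewrite ltn_eqF.
  exact: ltn_trans k1 kp.
have A_congr := singular_congr p_pr p_odd zetaP phiP phi0 OA A_lam
  (exp_principal_ideal lamO Aa) sz Kalpha sA mu_gt0 vmu.
have d0 := prim_order_gt0 dP.
split.
  rewrite ltn_neqAle d0 andbT; apply/eqP => d1; move: dP; rewrite -d1 => /prim_expr_order.
  rewrite expr1 => /(congr1 (fun x => x * mu%:R)); rewrite divfK // mul1r => vE.
  by rewrite vE eqxx in vmu.
apply: (@primes_of_singular_Q_field L p v mu zeta sigma A (alpha ^+ p.-1 * zeta ^+ w)) => //.
- by apply/eqP => A0; apply: A_lam; rewrite A0; exact: (multiples0 _ (oi_subring _)).
- by apply/negP => Kr; apply: nA; exists r.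
- by apply: rpredM; apply: rpredX => //; exact: zeta_K.
- by rewrite s_omega mulrA.
- exists b; split=> //; first by move=> /principalP.
  exact: exp_principal_ideal lamO gamma1.
(* The places are permuted by mu / v, the inverse of v / mu, which is its power d - 1; and d - 1 is
   prime to d. *)
- rewrite -invf_div.
  have -> : (v%:R / mu%:R : 'F_p)^-1 = (v%:R / mu%:R) ^+ d.-1.
    have vmu0 : (v%:R / mu%:R : 'F_p) != 0 by rewrite (prim_root_eq0 dP) -lt0n.
    apply: (mulfI vmu0); rewrite mulfV //.
    by rewrite -exprS prednK // (prim_expr_order dP).
  by rewrite (prim_root_exp_coprime _ dP) coprimePn.
Qed.
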